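(* Let $C>0$ be a constant and $K$ a number field. Then there exist uncountably many algebraic extensions $F$ of $K$ such that $\mathcal{N}(F)>C$.
   Context: Let $\bar{\mathbb{Q}}$ be an algebraic closure of $\mathbb{Q}$; number fields and their algebraic extensions are regarded as subfields of $\bar{\mathbb{Q}}$. Let $h:\bar{\mathbb{Q}}\to[0,\infty)$ be the absolute logarithmic Weil height. For $S\subseteq\bar{\mathbb{Q}}$ the Northcott number of $S$ is $\mathcal{N}(S)=\inf\{t\in[0,\infty) : \#\{\alpha\in S : h(\alpha)<t\}=\infty\}\in[0,\infty]$, with the convention $\inf\emptyset=\infty$. *)

(* Defs.v *)
From HB Require Import structures.
From mathcomp Require Export all_boot all_order all_algebra all_field.
From mathcomp Require Export finmap complex.
From mathcomp Require Export all_classical all_reals all_analysis.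

Set Implicit Arguments.
Unset Strict Implicit.
Unset Printing Implicit Defensive.

Import Order.TTheory GRing.Theory Num.Theory.

Local Open Scope classical_set_scope.
Local Open Scope ring_scope.

(* The algebraic closure of Q is algC; number fields and their algebraic
   extensions are subsets of algC. *)

(* In a field, divring_closed (1, x - y and x / y, with x / 0 = 0) is exactly
   being a subfield. *)
Definition subfield_of_algC (F : set algC) : Prop :=
  GRing.divring_closed (mem F).

(* Finite degree over Q: F is the Q-linear span of a finite sequence. *)
Definition number_field (K : set algC) : Prop :=
  subfield_of_algC K /\ exists s : seq algC, K = [set` Crat_span s].

Definition algebraic_extension (K F : set algC) : Prop :=
  [/\ subfield_of_algC F, K `<=` F &
      forall x, F x ->
        exists p : {poly algC}, [/\ p != 0, p \is a polyOver (mem K) & root p x]].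

Section Places.
Variable L : fieldExtType rat.

(* A finite place is given by its normalized discrete valuation (one for each
   nonzero prime ideal of the ring of integers of L). The value +oo at 0 is
   replaced by the dummy value 0, so that each place is exactly one function. *)
Record finite_place (w : L -> int) : Prop := FinitePlace {
  finite_place0 : w 0 = 0;
  finite_placeM : forall x y, x != 0 -> y != 0 -> w (x * y) = w x + w y;
  finite_placeD : forall x y, x != 0 -> y != 0 -> x + y != 0 ->
    Num.min (w x) (w y) <= w (x + y);
  finite_place_onto : forall n : int, exists2 x, x != 0 & w x = n }.

Definition valuation_ring (w : L -> int) : set L :=
  [set x | x = 0 \/ 0 <= w x].

Definition valuation_ideal (w : L -> int) : set L :=
  [set x | x = 0 \/ 0 < w x].

Definition residue_class (w : L -> int) (x : L) : set L :=
  [set x + m | m in valuation_ideal w].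

(* Junk value 0 for an infinite set; the residue fields of the finite places
   of a number field are finite. *)
Definition residue_card (w : L -> int) : nat :=
  (#|` fset_set [set residue_class w x | x in valuation_ring w]|)%fset.

End Places.

Section Height.
Variable R : realType.

(* |x|_w to the power of the local degree of w, i.e. N(w)^(- w(x)). *)
Definition finite_place_norm (L : fieldExtType rat) (w : L -> int) (x : L) : R :=
  if x == 0 then 0 else ((residue_card w)%:R : R) ^ (- w x).

Definition log_plus (t : R) : R := ln (Num.max 1 t).

Definition complex_embedding (L : fieldExtType rat) (s : L -> R[i]) : Prop :=
  exists f : {rmorphism L -> R[i]}, s = f.

(* (1 / [L : Q]) * \sum_v [L_v : Q_v] log^+ |x|_v over the places v of L. The
   infinite places are summed through the complex embeddings of L, so that a
   pair of conjugate embeddings accounts for the local degree 2. Only finitely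
   many terms are nonzero, hence the value is a real number. *)
Definition field_height (L : fieldExtType rat) (x : L) : \bar R :=
  (((\dim {:L})%:R^-1)%:E *
   (\esum_(s in [set s | complex_embedding s])
       (log_plus (Normc.normc (s x)))%:E
    + \esum_(w in [set w | finite_place w])
       (log_plus (finite_place_norm w x))%:E))%E.

(* The absolute logarithmic Weil height, computed in L = Q(a); the value does
   not depend on the number field containing a. *)
Definition weil_height (a : algC) : \bar R :=
  let: existT L (existT _ (exist2 s _ _)) := num_field_exists [:: a] in
  @field_height L s`_0.

Definition northcott_number (S : set algC) : \bar R :=
  ereal_inf [set t%:E | t in
    [set t : R | 0 <= t /\
       infinite_set [set a | S a /\ (weil_height a < t%:E)%E]]].

End Height.

(* Main.v *)
From HB Require Import structures.
Require Import Defs.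
From mathcomp Require Import ring zify.
Import Order.TTheory GRing.Theory Num.Theory.
Local Open Scope classical_set_scope.
Local Open Scope ring_scope.

(** The extensions are unions of towers K = K_0 < K_1 < K_2 < ... in which
    K_(n+1) = K_n(sqrt p_n) for a prime p_n.  Put T = C + 1.

    Every element of K_n(sqrt p) has degree at most twice that of K_n, a bound
    that does not depend on p.  By Northcott's theorem ([northcott_finite]) only
    finitely many numbers of that degree have height below T.  Let E be the set
    of those that lie outside K_n, and choose p such that sqrt p lies outside
    the number field generated by K_n and E.  An element a + b * sqrt p of E
    would have b != 0, and would put sqrt p into that number field; so
    K_n(sqrt p) meets E nowhere ([quadratic_avoiding]).  Hence no element of the
    tower outside K has height below T, and K itself has only finitely many
    such elements.  Neither ramification nor discriminants enter.

    Since E may be any finite set disjoint from K_n, the construction also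
    diagonalizes: against an enumeration G_0, G_1, ... of fields, stage n either
    finds G_n inside K_n, which is smaller than the union, or picks an element
    of G_n outside K_n and keeps it out of all later stages
    ([diagonal_extension]).  So no countable family contains all the extensions.

    A suitable p exists because the square roots of distinct primes are linearly
    independent over the rationals ([sqrt_fieldP], [sqrt_span_free]).

    Northcott's theorem needs only single terms of the height of x in L = Q(x).
    If the height is bounded, so is each complex conjugate of x, and so is
    N(w)^(-w(x)) at each finite place w where x has a pole.  The latter bounds
    both the pole order and the residue characteristic, so that one integer b,
    depending only on the bounds, clears all poles.  Then b * x is an algebraic
    integer: a non-integral element has a pole at some finite place
    ([exists_negative_place]).  Its conjugates are bounded, so its minimal
    polynomial is one of finitely many.  The place is obtained from a subring of
    L that is maximal among those containing 1/x but not x.  Such a ring is a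
    valuation ring, and its valuation is discrete because L is finite over the
    rationals. *)

Set Implicit Arguments.
Unset Strict Implicit.
Unset Printing Implicit Defensive.

(** * Maximal subrings without a given inverse *)

Section Subring.
Variable L : fieldType.
Implicit Types (A B : set L) (p q : {poly L}) (x y z : L).

Definition subring_set A : Prop :=
  [/\ A 1, forall x y, A x -> A y -> A (x - y) &
      forall x y, A x -> A y -> A (x * y)].

Definition poly_over A p : Prop := forall i, A p`_i.

Definition adjoin A z : set L :=
  [set x | exists2 p, poly_over A p & x = p.[z]].

Section Closure.
Variable A : set L.
Hypothesis ringA : subring_set A.

Lemma subring1 : A 1. Proof. by case: ringA. Qed.

Lemma subringB x y : A x -> A y -> A (x - y).
Proof. by case: ringA => _ + _; apply. Qed.

Lemma subringM x y : A x -> A y -> A (x * y).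
Proof. by case: ringA => _ _; apply. Qed.

Lemma subring0 : A 0.
Proof. by rewrite -(subrr 1); apply: subringB; apply: subring1. Qed.

Lemma subringN x : A x -> A (- x).
Proof. by move=> Ax; rewrite -sub0r; apply: subringB => //; apply: subring0. Qed.

Lemma subringD x y : A x -> A y -> A (x + y).
Proof. by move=> Ax Ay; rewrite -[y]opprK; apply/subringB/subringN. Qed.

Lemma subringX x n : A x -> A (x ^+ n).
Proof.
move=> Ax; elim: n => [|n IHn]; first exact: subring1.
by rewrite exprS; apply: subringM.
Qed.

Lemma subring_sum I (r : seq I) (P : pred I) (F : I -> L) :
  (forall i, P i -> A (F i)) -> A (\sum_(i <- r | P i) F i).
Proof.
by move=> AF; elim/big_ind: _ => //; [apply: subring0 | apply: subringD].
Qed.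

Lemma subring_nat n : A n%:R.
Proof.
elim: n => [|n IHn]; first exact: subring0.
by rewrite -natr1; apply/subringD/subring1.
Qed.

Lemma subring_int (n : int) : A n%:~R.
Proof.
case: n => n; first exact: subring_nat.
by rewrite NegzE mulrNz; apply/subringN/subring_nat.
Qed.

Lemma adjoin_sub z : A `<=` adjoin A z.
Proof.
move=> x Ax; exists x%:P; last by rewrite hornerC.
by move=> i; rewrite coefC; case: eqP => // _; apply: subring0.
Qed.

Lemma adjoin_gen z : adjoin A z z.
Proof.
exists 'X; last by rewrite hornerX.
by move=> i; rewrite coefX; apply: subring_nat.
Qed.

Lemma adjoin_subring z : subring_set (adjoin A z).
Proof.
split=> [|_ _ [p Ap ->] [q Aq ->]|_ _ [p Ap ->] [q Aq ->]].
- exact/adjoin_sub/subring1.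
- exists (p - q); last by rewrite hornerD hornerN.
  by move=> i; rewrite coefB; apply: subringB.
- exists (p * q); last by rewrite hornerM.
  move=> i; rewrite coefM; apply: subring_sum => j _; exact: subringM.
Qed.

(** Clearing denominators in an element of [A[z^-1]]. *)
Lemma horner_inv_clear p z : A z -> poly_over A p ->
  A (p.[z^-1] * z ^+ size p).
Proof.
move=> Az Ap; have [->|z0] := eqVneq z 0.
  rewrite expr0n; case: eqP => [/eqP|_]; last by rewrite mulr0; apply: subring0.
  by rewrite size_poly_eq0 => /eqP->; rewrite horner0 mul0r; apply: subring0.
rewrite horner_coef mulr_suml; apply: subring_sum => i _.
rewrite -mulrA; apply: subringM => //.
rewrite exprVn mulrC -expfB // ?ltn_ord //; exact: subringX.
Qed.

End Closure.

Section Maximal.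
Variables (A : set L) (y : L).
Hypotheses (ringA : subring_set A) (y0 : y != 0) (Ay : A y).
Hypothesis AyV : ~ A y^-1.
Hypothesis maxA : forall B, subring_set B -> A `<=` B -> ~ B y^-1 -> B `<=` A.

Lemma maximal_adjoin z : ~ A z -> exists2 p, poly_over A p & y * p.[z] = 1.
Proof.
move=> Az; have [[p Ap yVE]|nB] := EM (adjoin A z y^-1).
  by exists p => //; rewrite -yVE divff.
case: Az; apply: (maxA _ _ nB (adjoin_gen ringA z)).
  exact: adjoin_subring.
exact: adjoin_sub.
Qed.

Lemma one_sub_neq0 b : A b -> 1 - y * b != 0.
Proof.
move=> Ab; apply/eqP => /eqP; rewrite subr_eq0 => /eqP yb.
by apply: AyV; rewrite -[y^-1]mulr1 yb mulKf.
Qed.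

(** Otherwise maximality puts [y^-1] into [A[u^-1]] with [u = 1 - y * b].  Then
    [y^-1 * u ^+ n] lies in [A] for some [n], and [u ^+ n] is 1 modulo [y], so [y^-1]
    lies in [A]. *)
Lemma one_subV b : A b -> A (1 - y * b)^-1.
Proof.
move=> Ab; apply: contrapT => /maximal_adjoin[p Ap].
set u := 1 - y * b => yp.
have Au : A u by apply: (subringB ringA (subring1 ringA)); apply: subringM.
have [c Ac uE] : exists2 c, A c & u ^+ size p = 1 - y * c.
  elim: (size p) => [|n [c Ac uE]].
    by exists 0; [apply: subring0|rewrite mulr0 subr0].
  exists (b + c - y * b * c); last by rewrite exprS uE /u; ring.
  apply: (subringB ringA); first exact: (subringD ringA).
  by do 2![apply: (subringM ringA) => //].
apply: AyV.
have := subringD ringA (horner_inv_clear ringA Au Ap) Ac.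
suff -> : p.[u^-1] * u ^+ size p + c = y^-1 by [].
apply: (mulfI y0); rewrite mulrDr mulrA yp mul1r uE divff //; ring.
Qed.

(** Of two relations [y * p(z) = 1] and [y * q(1/z) = 1], say with [q] of the
    smaller degree, the second expresses [z ^+ deg p] by lower powers of [z], as
    [1 - y * q`_0] is a unit.  Substituting this into the first relation lowers
    the degree of [p], whence an infinite descent. *)
Lemma no_inverse_relations n p q z : (size p + size q <= n)%N -> z != 0 ->
  poly_over A p -> poly_over A q -> y * p.[z] = 1 -> y * q.[z^-1] = 1 -> False.
Proof.
elim: n p q z => [|n IHn] p q z.
  rewrite leqn0 addn_eq0 => /andP[+ _] _ _ _ + _.
  by rewrite size_poly_eq0 => /eqP->; rewrite horner0 mulr0 => /esym/eqP;
    rewrite oner_eq0.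
wlog le_qp : p q z / (size q <= size p)%N.
  move=> IHle; have [/IHle|/ltnW /IHle IHle'] := leqP (size q) (size p).
    exact.
  move=> szpq z0 Ap Aq yp yq; apply: (IHle' z^-1) => //.
  - by rewrite addnC.
  - by rewrite invr_eq0.
  - by rewrite invrK.
move=> szpq z0 Ap Aq yp yq.
case szp : (size p) => [|[|N]].
- move/eqP: szp; rewrite size_poly_eq0 => /eqP p0.
  by move/esym/eqP: yp; rewrite p0 horner0 mulr0 oner_eq0.
- have pC : p = (p`_0)%:P by apply: size1_polyC; rewrite szp.
  apply: AyV; suff -> : y^-1 = p`_0 by [].
  by rewrite -[y^-1]mulr1 -yp {1}pC hornerC mulKf.
set M := N.+1.
have u0 := one_sub_neq0 (Aq 0); have Au := one_subV (Aq 0).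
set u := 1 - y * q`_0 in u0 Au.
pose c i := y * u^-1 * q`_(M - i).
have Ac i : A (c i) by do 2![apply: (subringM ringA) => //].
(* This is the second relation multiplied by [z ^+ M] and divided by [u]. *)
have cE : \sum_(i < M) c i * z ^+ i = z ^+ M.
  apply: (mulfI u0); rewrite mulr_sumr.
  transitivity (y * (\sum_(i < M) q`_i.+1 * z^-1 ^+ i.+1) * z ^+ M).
    rewrite mulr_sumr mulr_suml (reindex_inj rev_ord_inj) /=.
    apply: eq_bigr => i _; rewrite /c subKn; last exact: ltn_ord.
    have -> : z ^+ M = z ^+ (M - i.+1) * z ^+ i.+1 by rewrite -exprD subnK.
    rewrite exprVn.
    have: z ^+ i.+1 != 0 by rewrite expf_neq0.
    by move: (z ^+ i.+1) => t t0; field; rewrite t0 u0.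
  have qM : (size q <= M.+1)%N by rewrite -szp.
  have := horner_coef_wide z^-1 qM.
  rewrite big_ord_recl /= expr0 mulr1 => qE.
  suff -> : y * (\sum_(i < M) q`_i.+1 * z^-1 ^+ i.+1) = u by [].
  by apply: (addrI (y * q`_0)); rewrite -mulrDr -qE yq /u; ring.
pose p' := \poly_(i < M) (p`_i + p`_M * c i).
apply: (IHn p' q z) => //.
- have := size_poly M (fun i => p`_i + p`_M * c i); rewrite -/p'.
  move: szpq; rewrite szp /M; lia.
- move=> i; rewrite coef_poly; case: ifP => _; last exact: subring0.
  by apply: (subringD ringA) => //; apply: (subringM ringA).
- rewrite horner_poly; under eq_bigr do rewrite mulrDl -mulrA.
  rewrite big_split /= -mulr_sumr cE -yp horner_coef szp.
  by rewrite [in RHS]big_ord_recr.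
Qed.

(** Chevalley's theorem: were neither [z] nor [z^-1] in [A], maximality would give
    [y^-1] as a polynomial in each of them. *)
Lemma maximal_valuation z : A z \/ A z^-1.
Proof.
have [->|z0] := eqVneq z 0; first by left; apply: subring0.
apply: contrapT => /not_orP[/maximal_adjoin[p Ap yp] /maximal_adjoin[q Aq yq]].
exact: (no_inverse_relations (leqnn _) z0 Ap Aq yp yq).
Qed.

End Maximal.

Lemma exists_maximal_subring (A0 : set L) y : subring_set A0 -> A0 y -> ~ A0 y^-1 ->
  exists A, [/\ subring_set A, A y, ~ A y^-1 &
    forall B, subring_set B -> A `<=` B -> ~ B y^-1 -> B `<=` A].
Proof.
move=> ring0 A0y A0V.
(* The empty set is admitted because it is the union of the empty chain. *)
pose P (A : set L) := A = set0 \/ [/\ subring_set A, A y & ~ A y^-1].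
have [F FP Ftot|A [PA maxA]] := @Zorn_bigcup L P.
  have [[B [FB B0]]|F0] := EM (exists B, F B /\ B !=set0); last first.
    left; apply/seteqP; split=> // x [B FB Bx].
    by case: F0; exists B; split=> //; exists x.
  have good C x : F C -> C x -> [/\ subring_set C, C y & ~ C y^-1].
    by move=> FC Cx; case: (FP C FC) => // C0; rewrite C0 in Cx.
  have common x z : (\bigcup_(X in F) X) x -> (\bigcup_(X in F) X) z ->
      exists C, [/\ F C, subring_set C, C x & C z].
    move=> [C FC Cx] [D FD Dz].
    have [rC _ _] := good C x FC Cx; have [rD _ _] := good D z FD Dz.
    by case: (Ftot C D FC FD) => CD; [exists D|exists C]; split=> //; apply: CD.
  right; case: B0 => x Bx; have [rB By BV] := good B x FB Bx; split.
  - split; first by exists B => //; apply: subring1.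
    + move=> a b Ua Ub; have [C [FC rC Ca Cb]] := common a b Ua Ub.
      by exists C => //; apply: subringB.
    + move=> a b Ua Ub; have [C [FC rC Ca Cb]] := common a b Ua Ub.
      by exists C => //; apply: subringM.
  - by exists B.
  - by case=> C FC CV; have [_ _] := good C _ FC CV.
case: PA => [A_0|[rA Ay AV]]; last first.
  exists A; split=> // B rB AB BV; apply: contrapT => nBA.
  by apply: (maxA B); [split|right; split=> //; apply: AB].
case: (maxA A0); last by right.
by rewrite A_0; split=> // /(_ y A0y).
Qed.

End Subring.

(** * Places from valuation rings *)

Section ExistsPlace.
Variable L : fieldExtType rat.
Implicit Types (A : set L) (x y z u v : L).

Lemma natr_ext_eq0 n : (n%:R == 0 :> L) = (n == 0)%N.
Proof.
by rewrite -(rmorph_nat (in_alg L)) fmorph_eq0 pnatr_eq0.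
Qed.

Lemma in_alg_ratE (r : rat) : in_alg L r = (numq r)%:~R / (denq r)%:~R.
Proof. by rewrite -{1}[r]divq_num_den fmorph_div !rmorph_int. Qed.

(** The minimal polynomial, padded with zero coefficients to a length that does
    not depend on [z]. *)
Lemma rat_relation z : exists c : nat -> rat,
  (exists2 i, (i <= \dim {:L})%N & c i != 0) /\
  \sum_(i < (\dim {:L}).+1) in_alg L (c i) * z ^+ i = 0.
Proof.
set p := minPoly 1%AS z; have szp : (size p <= (\dim {:L}).+1)%N.
  have := dim_Fadjoin 1%AS z; rewrite dimv1 muln1 => dimE.
  by rewrite size_minPoly ltnS -dimE dimvS ?subvf.
have c_ex i : exists r : rat, p`_i = in_alg L r.
  have /polyOverP/(_ i)/vlineP[r ->] := minPolyOver 1%AS z.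
  by exists r.
have [c cE] := choice c_ex; exists c; split.
  exists (size p).-1; first by rewrite -ltnS prednK // size_poly_gt0 monic_neq0 ?monic_minPoly.
  apply: contraNneq (oner_neq0 L) => c0.
  by rewrite -(monicP (monic_minPoly 1%AS z)) lead_coefE cE c0 rmorph0.
under eq_bigr do rewrite -cE; rewrite -(horner_coef_wide _ szp).
exact: minPolyxx.
Qed.

Section Valuation.
Variables (A : set L) (p : nat).
Hypotheses (ringA : subring_set A) (valA : forall z, A z \/ A z^-1).
Hypotheses (pr_p : prime p) (ApV : ~ A p%:R^-1).

Definition unit_in u : Prop := A u /\ A u^-1.

Lemma unit_in1 : unit_in 1.
Proof. by split; rewrite ?invr1; apply: (subring1 ringA). Qed.

Lemma unit_inM u v : unit_in u -> unit_in v -> unit_in (u * v).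
Proof.
by move=> [Au Auv] [Av Avv]; split; rewrite ?invfM; apply: (subringM ringA).
Qed.

Lemma unit_inV u : unit_in u -> unit_in u^-1.
Proof. by move=> [Au Auv]; split=> //; rewrite invrK. Qed.

Lemma unit_inX u n : unit_in u -> unit_in (u ^+ n).
Proof.
move=> Uu; elim: n => [|n IHn]; first exact: unit_in1.
by rewrite exprS; apply: unit_inM.
Qed.

(** A valuation ring is local. *)
Lemma one_add_nonunit x : A x -> ~ A x^-1 -> unit_in (1 + x).
Proof.
move=> Ax AxV; have A1 := subring1 ringA.
have [x0|x0] := eqVneq x 0; first by case: AxV; rewrite x0 invr0; apply: subring0.
have x1 : 1 + x != 0.
  apply/eqP => /eqP; rewrite addrC addr_eq0 => /eqP xE; apply: AxV.
  by rewrite xE invrN1; apply: (subringN ringA).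
split; first exact: (subringD ringA).
have [A1x|A1x] := valA (x / (1 + x)).
  have -> : (1 + x)^-1 = 1 - x / (1 + x) by field.
  exact: (subringB ringA).
case: AxV; have -> : x^-1 = (x / (1 + x))^-1 - 1 by field; rewrite x0 x1.
exact: (subringB ringA).
Qed.

(** Ultrametric domination: in a valuation ring one of [u / v] and [v / u] is a
    non-unit [x], and [1 + x] is then a unit. *)
Lemma add_dominated u v : u != 0 -> v != 0 -> ~ unit_in (u / v) ->
  u + v != 0 /\ (unit_in ((u + v) / u) \/ unit_in ((u + v) / v)).
Proof.
wlog Auv : u v / A (u / v).
  move=> IH u0 v0 nU; have [Auv|Auv] := valA (u / v); first exact: IH.
  have [||uv0 U] := IH v u _ v0 u0.
  - by rewrite -invf_div.
  - by move=> /unit_inV; rewrite invf_div.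
  - by rewrite addrC; split=> //; case: U => ?; [right|left].
move=> u0 v0 nU.
have Uuv : unit_in (1 + u / v) by apply: one_add_nonunit => // ?; apply: nU.
have E : (u + v) / v = 1 + u / v by rewrite mulrDl divff // addrC.
split; last by right; rewrite E.
apply/eqP => uv0; case: Uuv => _; rewrite -E uv0 mul0r.
move/eqP: uv0; rewrite addr_eq0 => /eqP uE _; case: nU.
rewrite uE mulNr divff //; split; rewrite ?invrN1.
  exact: (subringN ringA (subring1 ringA)).
exact: (subringN ringA (subring1 ringA)).
Qed.

(** A sum of terms with pairwise distinct valuations has the valuation of one of
    its terms, so it cannot vanish. *)
Lemma relation_two_terms (t : nat -> L) n i0 : (i0 < n)%N -> t i0 != 0 ->
  \sum_(i < n) t i = 0 ->
  exists i j, [/\ (i < j)%N, (j < n)%N, t i != 0, t j != 0 & unit_in (t i / t j)].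
Proof.
move=> i0n ti0 t_sum; apply: contrapT => nex.
have [dom|[S0 [i [iN ti Ui]]]] :
    (forall i, (i < n)%N -> t i = 0) \/ (\sum_(i < n) t i != 0 /\
      exists i, [/\ (i < n)%N, t i != 0 & unit_in ((\sum_(i < n) t i) / t i)]).
- move: (leqnn n); elim: {-2}n => [|m IHm] mn; first by left.
  have [|allz|[S0 [i [im ti Ui]]]] := IHm; first exact: ltnW.
    rewrite big_ord_recr /= big1 ?add0r; last by move=> [i im] _; rewrite allz.
    have [tm|tm] := eqVneq (t m) 0.
      by left=> i; rewrite ltnS leq_eqVlt => /predU1P[->|/allz].
    right; split=> //; exists m; split=> //; rewrite divff //; exact: unit_in1.
  rewrite big_ord_recr /=; set S := \sum_(i < m) t i in S0 Ui *.
  have [tm|tm] := eqVneq (t m) 0.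
    by right; rewrite tm addr0; split=> //; exists i; split=> //; apply: ltnW.
  have [|Sm0 dom] := add_dominated S0 tm.
    move=> U; apply: nex; exists i, m; split=> //.
    have := unit_inM (unit_inV Ui) U.
    by rewrite invf_div mulrA divfK.
  right; split=> //; case: dom => U; last by exists m.
  exists i; split=> //; first exact: ltnW.
  have := unit_inM U Ui; by rewrite mulrA divfK.
- by rewrite (dom _ i0n) eqxx in ti0.
- by rewrite t_sum eqxx in S0.
Qed.

Lemma p_neq0 : p%:R != 0 :> L.
Proof. by rewrite natr_ext_eq0 -lt0n prime_gt0. Qed.

Lemma unit_coprime m : (0 < m)%N -> ~~ (p %| m)%N -> unit_in m%:R.
Proof.
move=> m0 pm; split; first exact: subring_nat.
have m0' : m%:R != 0 :> L by rewrite natr_ext_eq0 -lt0n.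
have := Bezoutl p m0; rewrite [gcdn m p]gcdnC (eqP (_ : coprime p m)); last first.
  by rewrite prime_coprime.
move=> [v _ /dvdnP[k kE]].
have E : 1 = k%:R * m%:R - v%:R * p%:R :> L.
  by rewrite -!natrM -kE natrD addrK.
have p0 := p_neq0; have nA := subring_nat ringA.
have [Apm|Amp] := valA (m%:R / p%:R).
  case: ApV; have -> : p%:R^-1 = k%:R * (m%:R / p%:R) - v%:R :> L.
    by apply: (mulIf p0); rewrite mulVf // mulrBl -mulrA divfK.
  by apply: (subringB ringA) => //; apply: (subringM ringA).
have -> : m%:R^-1 = k%:R - v%:R * (m%:R / p%:R)^-1 :> L.
  apply: (mulIf m0'); rewrite mulVf // mulrBl -mulrA invf_div divfK //.
by apply: (subringB ringA) => //; apply: (subringM ringA).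
Qed.

Lemma int_unit_part (m : int) : m != 0 ->
  exists k : int, unit_in (m%:~R / (p%:R : L) ^ k).
Proof.
wlog m0 : m / 0 < m.
  move=> IH mn0; have [m0|m0|m0] := ltrgt0P m; first exact: IH.
    have [||k U] := IH (- m); rewrite ?oppr_gt0 ?oppr_eq0 //.
    exists k; rewrite -[m]opprK mulrNz mulNr -mulN1r; apply: unit_inM => //.
    by split; rewrite ?invrN1; apply: (subringN ringA); apply: (subring1 ringA).
  by rewrite m0 eqxx in mn0.
case: m m0 => // m m0 _; have [k pk ->] := @pfactor_coprime p m pr_p m0.
exists (logn p m); rewrite -pmulrn natrM natrX -exprnP mulfK.
  apply: unit_coprime; last by rewrite -prime_coprime.
  by rewrite lt0n; apply: contraTneq pk => ->; rewrite prime_coprime // dvdn0.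
by rewrite expf_neq0 // p_neq0.
Qed.

Lemma rat_unit_part (r : rat) : r != 0 ->
  exists k : int, unit_in (in_alg L r / (p%:R : L) ^ k).
Proof.
move=> r0; have [|k Uk] := @int_unit_part (numq r); first by rewrite numq_eq0.
have [|l Ul] := @int_unit_part (denq r); first by rewrite denq_eq0.
exists (k - l); rewrite in_alg_ratE expfzDr ?p_neq0 // -invr_expz.
have := unit_inM Uk (unit_inV Ul); congr unit_in.
rewrite !invfM !invrK; ring.
Qed.

Let e := (\dim {:L})`!.

(** Two terms of a rational relation of [z] have the same valuation, so some power
    [z ^+ n] with [n] at most the degree of [L] has the valuation of a rational
    number, that is, of a power of [p].  The factorial is an exponent that serves
    all [z] at once; this is what makes the valuation discrete. *)
Lemma power_unit_part z : z != 0 ->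
  exists k : int, unit_in (z ^+ e / (p%:R : L) ^ k).
Proof.
move=> z0; have [c [[i0 i0d ci0] cz]] := rat_relation z.
pose t i := in_alg L (c i) * z ^+ i.
have t0 i : (t i != 0) = (c i != 0).
  by rewrite mulf_eq0 fmorph_eq0 expf_eq0 (negPf z0) andbF orbF.
have [||i [j [ij jd]]] := @relation_two_terms t (\dim {:L}).+1 i0 _ _ cz.
- by rewrite ltnS.
- by rewrite t0.
rewrite !t0 => ci cj Uij.
have [k Uk] := rat_unit_part ci; have [l Ul] := rat_unit_part cj.
have p0 := p_neq0.
have Un : unit_in (z ^+ (j - i) / (p%:R : L) ^ (k - l)).
  have := unit_inM (unit_inV Uij) (unit_inM Uk (unit_inV Ul)).
  congr unit_in; rewrite /t expfzDr // -invr_expz.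
  have -> : z ^+ j = z ^+ (j - i) * z ^+ i by rewrite -exprD subnK // ltnW.
  have := expf_neq0 (j - i) z0; have := expf_neq0 i z0.
  move: (z ^+ i) (z ^+ (j - i)) => a b a0 b0.
  have := expfz_neq0 k p0; have := expfz_neq0 l p0.
  move: (_ ^ k) (_ ^ l) => P Q Q0 P0.
  have : in_alg L (c i) != 0 by rewrite fmorph_eq0.
  have : in_alg L (c j) != 0 by rewrite fmorph_eq0.
  move: (in_alg L _) (in_alg L _) => C D C0 D0.
  by field; rewrite a0 b0 P0 Q0 C0 D0.
have /dvdnP[q qE] : (j - i %| e)%N.
  by apply: dvdn_fact; rewrite subn_gt0 ij /= (leq_trans (leq_subr _ _)).
exists ((k - l) * q%:Z); have := unit_inX q Un.
by congr unit_in; rewrite qE expr_div_n -exprM mulnC -exprz_exp -exprnP.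
Qed.

Lemma p_power_unit (k : int) : unit_in ((p%:R : L) ^ k) -> k = 0.
Proof.
wlog k0 : k / 0 <= k.
  move=> IH U; have [k0|k0] := leP 0 k; first exact: IH.
  apply: oppr_inj; rewrite oppr0; apply: IH; first by rewrite oppr_ge0 ltW.
  by rewrite -invr_expz; apply: unit_inV.
case: k k0 => // -[|k] // _ [_ AkV]; case: ApV.
have -> : p%:R^-1 = p%:R ^+ k * (p%:R ^+ k.+1)^-1 :> L.
  by rewrite exprS invfM mulrCA mulfV ?mulr1 ?expf_neq0 // p_neq0.
apply: (subringM ringA) => //; by apply: (subringX ringA); apply: (subring_nat ringA).
Qed.

(** [V z] is the exponent [k] such that [z ^+ e] is a unit times [p ^ k]. *)
Theorem integer_valuation : exists V : L -> int,
  [/\ forall x y, x != 0 -> y != 0 -> V (x * y) = V x + V y,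
      forall x y, x != 0 -> y != 0 -> x + y != 0 ->
        Num.min (V x) (V y) <= V (x + y) &
      forall x, x != 0 -> A x <-> 0 <= V x].
Proof.
have V_ex z : exists k : int, z != 0 -> unit_in (z ^+ e / (p%:R : L) ^ k).
  by have [z0|/power_unit_part[k Uk]] := eqVneq z 0; [exists 0|exists k].
have [V VP] := choice V_ex.
have p0 := p_neq0; have pz k := expfz_neq0 k p0.
have Vuniq z k : z != 0 -> unit_in (z ^+ e / (p%:R : L) ^ k) -> V z = k.
  move=> z0 Uk; apply/eqP; rewrite -subr_eq0; apply/eqP/p_power_unit.
  have := unit_inM Uk (unit_inV (VP z z0)); congr unit_in.
  rewrite expfzDr // -invr_expz invf_div.
  have := expf_neq0 e z0; move: (z ^+ e) => a a0.
  by field; rewrite a0 pz.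
have VM x y : x != 0 -> y != 0 -> V (x * y) = V x + V y.
  move=> x0 y0; apply: Vuniq; first by rewrite mulf_neq0.
  have := unit_inM (VP x x0) (VP y y0); congr unit_in.
  by rewrite exprMn expfzDr // invfM mulrACA.
have VA x : x != 0 -> A x <-> 0 <= V x.
  move=> x0; have [Ue UeV] := VP x x0; split=> [Ax|].
    rewrite leNgt; apply/negP => V0.
    have [n nE] : exists n : nat, V x = - n.+1%:Z.
      by case: (V x) V0 => // n _; exists n; rewrite NegzE.
    apply: ApV; move: UeV; rewrite invf_div nE -exprnN => UeV.
    have -> : p%:R^-1 = p%:R ^+ n * (x ^+ e * ((p%:R ^+ n.+1)^-1 / x ^+ e)) :> L.
      have := expf_neq0 e x0; have := expf_neq0 n p0 => ? ?.
      by rewrite [x ^+ e * _]mulrC divfK // exprS invfM mulrCA mulfV ?mulr1.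
    apply: (subringM ringA); first by apply: (subringX ringA); apply: (subring_nat ringA).
    by apply: (subringM ringA) => //; apply: (subringX ringA).
  case: (V x) Ue => // n Ue _.
  have Axe : A (x ^+ e).
    rewrite -[x ^+ e](divfK (pz n)); apply: (subringM ringA) => //.
    by apply: (subringX ringA); apply: (subring_nat ringA).
  have [//|AxV] := valA x.
  have -> : x = x ^+ e * x^-1 ^+ e.-1.
    have: (0 < e)%N by rewrite fact_gt0.
    case: e => // n' _; rewrite exprS exprVn -mulrA mulfV ?mulr1 //.
    exact: expf_neq0.
  by apply: (subringM ringA) => //; apply: (subringX ringA).
exists V; split=> // x y x0 y0 xy0.
wlog le_xy : x y x0 y0 xy0 / V x <= V y.
  move=> IH; have [le_xy|/ltW le_yx] := leP (V x) (V y).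
    by rewrite -[V x](min_idPl le_xy); apply: IH.
  rewrite addrC -[V y](min_idPl le_yx); apply: IH => //.
  by rewrite addrC.
rewrite (min_idPl le_xy).
have E : x + y = x * (1 + y / x) by rewrite mulrDr mulr1 mulrCA mulfV ?mulr1.
have n0 : 1 + y / x != 0 by apply: contraNneq xy0 => n0; rewrite E n0 mulr0.
rewrite E VM // lerDl; apply/VA => //; apply: (subringD ringA (subring1 ringA)).
have yx0 : y / x != 0 by rewrite mulf_neq0 ?invr_neq0.
apply/VA => //; rewrite -(lerD2r (V x)) add0r -VM // divfK //.
Qed.

End Valuation.

(** The values form a nonzero subgroup of the integers; dividing by its positive
    generator makes the valuation surjective. *)
Lemma normalize_valuation (V : L -> int) x :
  (forall x y, x != 0 -> y != 0 -> V (x * y) = V x + V y) ->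
  (forall x y, x != 0 -> y != 0 -> x + y != 0 ->
        Num.min (V x) (V y) <= V (x + y)) ->
  x != 0 -> V x < 0 -> exists2 w, finite_place w & w x < 0.
Proof.
move=> VM VD x0 Vx.
have V1 : V 1 = 0.
  by apply: (addrI (V 1)); rewrite -VM ?mulr1 ?addr0 ?oner_eq0.
have VV z : z != 0 -> V z^-1 = - V z.
  move=> z0; apply: (addrI (V z)); rewrite -VM ?invr_eq0 // divff // V1; lia.
have VXn z n : z != 0 -> V (z ^+ n) = V z * n%:Z.
  move=> z0; elim: n => [|n IHn]; first by rewrite V1 mulr0.
  rewrite exprS VM ?expf_neq0 // IHn; lia.
have VX z k : z != 0 -> V (z ^ k) = V z * k.
  move=> z0; case: k => n; first exact: VXn.
  by rewrite NegzE -exprnN VV ?expf_neq0 // VXn // mulrN.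
have exg : exists n, `[< exists2 t, t != 0 & V t = n.+1%:Z >].
  exists `|V x|.-1; apply/asboolP; exists x^-1; rewrite ?invr_eq0 // VV //; lia.
case: (ex_minnP exg) => g /asboolP[t t0 Vt] ming.
pose G := g.+1%:Z.
have G0 : G != 0 by [].
have divG z : z != 0 -> (V z = (V z %/ G)%Z * G).
  move=> z0; rewrite [LHS](divz_eq _ G).
  have r0 := modz_ge0 (V z) G0; have rG := ltz_mod (V z) G0.
  suff -> : (V z %% G)%Z = 0 by rewrite addr0.
  have rV : (V z %% G)%Z = V (z * t ^ (- (V z %/ G)%Z)).
    rewrite VM ?expfz_neq0 // VX // Vt -/G {2}(divz_eq (V z) G); ring.
  apply/eqP; apply: contraT => rn0.
  have : (g <= `|(V z %% G)%Z|.-1)%N.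
    apply: ming; apply/asboolP; exists (z * t ^ (- (V z %/ G)%Z)).
      by rewrite mulf_neq0 ?expfz_neq0.
    rewrite -rV; move: r0 rn0; lia.
  move: r0 rn0 rG; rewrite /G; lia.
exists (fun z => if z == 0 then 0 else (V z %/ G)%Z); last first.
  by rewrite (negPf x0); have := divG x x0; move: Vx; rewrite /G; nia.
split; first by rewrite eqxx.
- move=> a b a0 b0; rewrite mulf_eq0 (negPf a0) (negPf b0) /=.
  apply: (mulIf G0); rewrite mulrDl -!divG ?mulf_neq0 //; exact: VM.
- move=> a b a0 b0 ab0; rewrite (negPf a0) (negPf b0) (negPf ab0).
  have Gp : 0 < G by [].
  rewrite -(ler_pM2r Gp) minr_pMl ?(ltW Gp) // -!divG //; exact: VD.
- move=> n; exists (t ^ n); first by rewrite expfz_neq0.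
  rewrite expfz_eq0 (negPf t0) andbF; apply: (mulIf G0); rewrite -divG ?expfz_neq0 //.
  by rewrite VX // Vt -/G mulrC.
Qed.

(** If [x] is not integral over the integers, then [x] is not a polynomial in
    [y = x^-1]: multiplying such an expression by a power of [x] would give a
    monic equation.  So there is a subring maximal among those that contain [y]
    but not [x].  Some prime [p] is not invertible in it, for otherwise it would
    contain the rationals, hence all polynomials in [y], hence [x]. *)
Theorem exists_negative_place x :
  (forall q : {poly int}, q \is monic -> (map_poly intr q).[x] != 0) ->
  exists2 w, finite_place w & w x < 0.
Proof.
move=> nint; have x0 : x != 0.
  by have := nint 'X (monicX _); rewrite map_polyX hornerX.
set y := x^-1; have y0 : y != 0 by rewrite invr_eq0.
pose Z : set L := [set z | exists q : {poly int}, z = (map_poly intr q).[y]].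
have ringZ : subring_set Z.
  split=> [|_ _ [q ->] [r ->]|_ _ [q ->] [r ->]].
  - by exists 1; rewrite rmorph1 hornerC.
  - by exists (q - r); rewrite rmorphB hornerD hornerN.
  - by exists (q * r); rewrite rmorphM hornerM.
have Zy : Z y by exists 'X; rewrite map_polyX hornerX.
have ZV : ~ Z y^-1.
  move=> [q]; rewrite invrK => xE.
  pose n := size q.
  pose r : {poly int} := 'X^(n.+1) - \poly_(i < n.+1) q`_(n - i)%N.
  have mon_r : r \is monic.
    rewrite monicE lead_coefDl ?lead_coefXn //.
    by rewrite size_polyN size_polyXn ltnS size_poly.
  have := nint r mon_r; rewrite rmorphB /= map_polyXn hornerD hornerN hornerXn.
  rewrite subr_eq0 => /eqP; apply.
  rewrite exprS {1}xE (@horner_coef_wide _ n.+1); last first.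
    by rewrite (leq_trans (size_poly _ _)).
  rewrite (@horner_coef_wide _ n.+1 (map_poly _ (poly _ _))); last first.
    by rewrite (leq_trans (size_poly _ _)) // size_poly.
  rewrite mulr_suml (reindex_inj rev_ord_inj) /=; apply: eq_bigr => i _.
  rewrite !coef_map /= coef_poly ltn_ord subSS -mulrA; congr (_ * _).
  rewrite /y exprVn mulrC -{1}(subnK (_ : (n - i <= n)%N)) ?leq_subr // exprD.
  by rewrite mulfK ?expf_neq0 // subKn // -ltnS.
have [A [ringA Ay AyV maxA]] := exists_maximal_subring ringZ Zy ZV.
have valA := maximal_valuation ringA y0 Ay AyV maxA.
have [p pr_p ApV] : exists2 p, prime p & ~ A p%:R^-1.
  apply: contrapT => nex.
  have Apr p : prime p -> A p%:R^-1.
    by move=> pr_p; apply: contrapT => nA; apply: nex; exists p.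
  have AnV n : A n.+1%:R^-1.
    elim/ltn_ind: n => n IHn; have [|n1] := leqP n.+1 1.
      by case: n {IHn} => // _; rewrite invr1; apply: (subring1 ringA).
    have := pdiv_dvd n.+1; have pr := pdiv_prime n1.
    move=> /dvdnP[m nE]; rewrite nE natrM invfM; apply: (subringM ringA); last exact: Apr.
    case: m nE => [|m] nE; first by rewrite mul0n in nE.
    apply: IHn; rewrite -ltnS nE ltn_Pmulr // prime_gt1 //.
  apply: AyV; have yK : y^-1 \in <<1; y>>%VS by rewrite rpredV memv_adjoin.
  rewrite -(Fadjoin_poly_eq (K := 1%AS) yK) horner_coef.
  apply: (subring_sum ringA) => i _; apply: (subringM ringA); last exact: subringX.
  have /polyOverP/(_ i)/vlineP[r ->] := Fadjoin_polyOver 1%AS y y^-1.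
  rewrite -[r%:A]/(in_alg L r) in_alg_ratE; apply: (subringM ringA).
    exact: subring_int.
  have := denq_gt0 r; case: (denq r) => // -[|n] // _; exact: AnV.
have [V [VM VD VA]] := integer_valuation ringA valA pr_p ApV.
apply: (normalize_valuation VM VD x0); rewrite ltNge.
by apply/negP => /VA -/(_ x0); rewrite /y invrK in AyV.
Qed.

End ExistsPlace.

(** * Residue fields of finite places *)

Section Residue.
Variables (L : fieldExtType rat) (w : L -> int).
Hypothesis w_place : finite_place w.
Implicit Types x y z : L.

Let wM x y : x != 0 -> y != 0 -> w (x * y) = w x + w y.
Proof. exact: finite_placeM. Qed.

(** Including zero here absorbs the dummy value of a place at zero, so that these
    sets are closed under the ring operations without side conditions. *)
Definition val_ge (n : int) : set L := [set x | x = 0 \/ n <= w x].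

Lemma valuation_idealE : valuation_ideal w = val_ge 1.
Proof. by apply/seteqP; split=> x [->|wx]; [left|right|left|right]. Qed.

Lemma place1 : w 1 = 0.
Proof. by apply: (addrI (w 1)); rewrite -wM ?mulr1 ?addr0 ?oner_eq0. Qed.

Lemma placeN x : w (- x) = w x.
Proof.
have wN1 : w (-1) = 0.
  have : w (-1) + w (-1) = 0.
    by rewrite -wM ?oppr_eq0 ?oner_eq0 // mulrNN mulr1 place1.
  by lia.
have [->|x0] := eqVneq x 0; first by rewrite oppr0.
by rewrite -mulN1r wM ?oppr_eq0 ?oner_eq0 // wN1 add0r.
Qed.

Lemma placeX x n : x != 0 -> w (x ^+ n) = w x * n%:Z.
Proof.
move=> x0; elim: n => [|n IHn]; first by rewrite place1 mulr0.
by rewrite exprS wM ?expf_neq0 // IHn; lia.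
Qed.

Lemma placeV x : x != 0 -> w x^-1 = - w x.
Proof.
by move=> x0; apply: (addrI (w x)); rewrite -wM ?invr_eq0 // divff // place1; lia.
Qed.

Lemma val_geD n x y : val_ge n x -> val_ge n y -> val_ge n (x + y).
Proof.
move=> [->|nx]; first by rewrite add0r.
move=> [->|ny]; first by rewrite addr0; right.
have [->|x0] := eqVneq x 0; first by rewrite add0r; right.
have [->|y0] := eqVneq y 0; first by rewrite addr0; right.
have [->|xy0] := eqVneq (x + y) 0; first by left.
right; apply: le_trans (finite_placeD w_place x0 y0 xy0).
by rewrite le_min nx.
Qed.

Lemma val_geN n x : val_ge n x -> val_ge n (- x).
Proof. by case=> [->|nx]; [left; rewrite oppr0|right; rewrite placeN]. Qed.

Lemma val_geB n x y : val_ge n x -> val_ge n y -> val_ge n (x - y).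
Proof. by move=> nx ny; apply/val_geD/val_geN. Qed.

Lemma val_geM m n x y : val_ge m x -> val_ge n y -> val_ge (m + n) (x * y).
Proof.
move=> [->|mx]; first by rewrite mul0r; left.
move=> [->|ny]; first by rewrite mulr0; left.
have [->|x0] := eqVneq x 0; first by rewrite mul0r; left.
have [->|y0] := eqVneq y 0; first by rewrite mulr0; left.
by right; rewrite wM //; apply: lerD.
Qed.

Lemma val_ge_sum n I (r : seq I) (P : pred I) (F : I -> L) :
  (forall i, P i -> val_ge n (F i)) -> val_ge n (\sum_(i <- r | P i) F i).
Proof.
by move=> nF; elim/big_ind: _ => //; [left | apply: val_geD].
Qed.

Lemma val_ge_nat n : val_ge 0 n%:R.
Proof.
elim: n => [|n IHn]; first by left.
by rewrite -natr1; apply: val_geD => //; right; rewrite place1.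
Qed.

Lemma val_ge_int (c : int) : val_ge 0 c%:~R.
Proof.
case: c => n; first exact: val_ge_nat.
by rewrite NegzE mulrNz; apply/val_geN/val_ge_nat.
Qed.

Lemma place_nat_ge0 n : 0 <= w n%:R.
Proof.
by case: (val_ge_nat n) => [->|//]; rewrite (finite_place0 w_place).
Qed.

(** If [w] vanished on all primes, it would vanish on the nonzero rationals.  An
    element [z] with [w z = -1] is a rational polynomial in [z^-1], whose terms
    would then all have nonnegative valuation. *)
Lemma place_prime : exists2 p, prime p & 0 < w p%:R.
Proof.
apply: contrapT => nex.
have wp p : prime p -> w p%:R = 0.
  move=> pr_p; apply/eqP; rewrite eq_le place_nat_ge0 andbT leNgt.
  by apply/negP => wp0; apply: nex; exists p.
have wn n : w n.+1%:R = 0.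
  elim/ltn_ind: n => n IHn; have [|n1] := leqP n.+1 1.
    by case: n {IHn} => // _; rewrite place1.
  have := pdiv_dvd n.+1; have pr := pdiv_prime n1.
  move: (pdiv _) pr => q pr_q /dvdnP[[|m]] nE; first by rewrite mul0n in nE.
  have q0 : q%:R != 0 :> L by rewrite natr_ext_eq0 -lt0n prime_gt0.
  have m0 : m.+1%:R != 0 :> L by rewrite natr_ext_eq0.
  rewrite nE natrM wM // (wp q) // addr0.
  by apply: IHn; rewrite -ltnS nE ltn_Pmulr // prime_gt1.
have rat_ge (r : rat) : val_ge 0 (in_alg L r).
  rewrite in_alg_ratE -[0]addr0; apply: val_geM; first exact: val_ge_int.
  have := denq_gt0 r; case: (denq r) => // -[|n] // _.
  by right; rewrite placeV ?natr_ext_eq0 // -pmulrn wn.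
have [z z0 wz] := finite_place_onto w_place (-1).
have zK : z \in <<1; z^-1>>%VS by rewrite -[z]invrK rpredV invrK memv_adjoin.
have : val_ge 0 z.
  rewrite -(Fadjoin_poly_eq (K := 1%AS) zK) horner_coef.
  apply: val_ge_sum => i _; rewrite -[0]addr0; apply: val_geM.
    have /polyOverP/(_ i)/vlineP[r ->] := Fadjoin_polyOver 1%AS z^-1 z.
    exact: rat_ge.
  by right; rewrite placeX ?invr_eq0 // placeV // wz; lia.
by case=> [zE|]; [rewrite zE eqxx in z0|rewrite wz].
Qed.

Lemma residue_classP x y : residue_class w x = residue_class w y <-> val_ge 1 (x - y).
Proof.
rewrite /residue_class valuation_idealE; split=> [xy|xy].
  have : [set x + m | m in val_ge 1] x by exists 0; rewrite ?addr0 //; left.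
  by rewrite xy => -[m Am <-]; rewrite addrC addKr.
apply/seteqP; split=> _ [m Am <-].
  by exists (x - y + m); [apply: val_geD|ring].
exists (m - (x - y)); last by ring.
by apply: val_geB.
Qed.

Section ResidueCharacteristic.
Variable p : nat.
Hypotheses (pr_p : prime p) (wp : 0 < w p%:R).

Lemma p_mul_ideal x : val_ge 0 x -> val_ge 1 (p%:R * x).
Proof. by move=> Vx; rewrite -[1]addr0; apply: val_geM => //; right. Qed.

Lemma bezout_prime (c : int) : ~~ (p%:Z %| c)%Z ->
  exists u v : int, u * c + v * p%:Z = 1.
Proof.
move=> pc; have [u [v uvE]] := Bezoutz c p%:Z; exists u, v.
by rewrite uvE; apply/eqP; rewrite -/(coprimez c p) coprimez_sym coprimezE /= prime_coprime.
Qed.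

Lemma int_in_ideal (c : int) : val_ge 1 c%:~R -> (p%:Z %| c)%Z.
Proof.
move=> c1; apply: contraT => /bezout_prime[u [v E]].
have : val_ge 1 (u%:~R * c%:~R + v%:~R * p%:R).
  apply: val_geD; first by rewrite -[1]add0r; apply: val_geM => //; apply: val_ge_int.
  by rewrite mulrC; apply/p_mul_ideal/val_ge_int.
rewrite (_ : _ + _ = 1); last by rewrite pmulrn -!intrM -intrD E.
by case=> [/eqP|]; rewrite ?oner_eq0 // place1.
Qed.

(** Linear independence over [Z/p] of the residue classes of [s], stated with
    integer coefficients so that it can be compared with independence over the
    rationals. *)
Definition residue_free (s : seq L) : Prop :=
  (forall i : 'I_(size s), val_ge 0 s`_i) /\
  forall c : 'I_(size s) -> int,
    val_ge 1 (\sum_i (c i)%:~R * s`_i) -> forall i, (p%:Z %| c i)%Z.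

(** Infinite descent: the coefficients of a vanishing combination are divisible
    by [p], and the quotients again form a vanishing combination. *)
Lemma residue_free_int s (c : 'I_(size s) -> int) : residue_free s ->
  \sum_i (c i)%:~R * s`_i = 0 -> forall i, c i = 0.
Proof.
move=> [_ free_s] c0 i.
have p0 : p%:R != 0 :> L by rewrite natr_ext_eq0 -lt0n prime_gt0.
have dvd_c j : (p%:Z ^+ j %| c i)%Z.
  elim: j c c0 => [|j IHj] c c0; first exact: dvd1z.
  have pc k : c k = (c k %/ p%:Z)%Z * p%:Z.
    by rewrite divzK //; apply: free_s; rewrite c0; left.
  rewrite pc exprSr dvdz_mul //; apply: (IHj (fun k => (c k %/ p%:Z)%Z)).
  apply: (mulIf p0); rewrite mul0r -[RHS]c0 mulr_suml; apply: eq_bigr => k _.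
  by rewrite [in RHS]pc intrM mulrAC.
apply/eqP; apply: contraT => ci0.
have := dvd_c `|c i|%N; rewrite dvdzE abszX /= => /dvdn_leq.
by rewrite absz_gt0 leqNgt ltn_expl ?prime_gt1 // => /(_ ci0).
Qed.

Lemma residue_free_free s : residue_free s -> free s.
Proof.
move=> fs; rewrite -[s]/(tval (in_tuple s)); apply/freeP => k k0 i.
pose c j := numq (k j) * \prod_(l | l != j) denq (k l).
have cE j : (c j)%:~R = (\prod_l denq (k l))%:~R * k j :> rat.
  rewrite (bigD1 j) //= [in RHS]intrM mulrAC -[X in _ = _ * X * _]divq_num_den.
  by rewrite mulrCA mulfV ?intr_eq0 ?denq_eq0 // mulr1 -intrM.
have ci0 : c i = 0.
  apply: (residue_free_int fs).
  transitivity ((\prod_l denq (k l))%:~R *: \sum_j k j *: s`_j); last by rewrite k0 scaler0.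
  rewrite scaler_sumr; apply: eq_bigr => j _.
  by rewrite scalerA -cE scaler_int mulrzl.
have := cE i; rewrite ci0 => /esym/eqP; rewrite mulf_eq0 intr_eq0.
case/orP => [|/eqP//]; rewrite prodf_seq_eq0 => /hasP[j _ /=].
by rewrite denq_eq0.
Qed.

(** A free sequence of size [n] spans at most [p ^ n] residue classes; if there are
    infinitely many, any class outside the span extends the sequence. *)
Lemma residue_free_extend s : residue_free s ->
  ~ finite_set [set residue_class w x | x in valuation_ring w] ->
  exists x, residue_free (x :: s).
Proof.
move=> [Vs free_s] inf.
pose comb (g : {ffun 'I_(size s) -> 'I_p}) := \sum_i (g i)%:R * s`_i.
pose cls := [set residue_class w (comb g) | g in [set: {ffun 'I_(size s) -> 'I_p}]].
have [x Vx ncls] : exists2 x, valuation_ring w x & ~ cls (residue_class w x).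
  apply: contrapT => nex; apply: inf; apply: (@sub_finite_set _ _ cls).
    move=> _ [x Vx <-]; apply: contrapT => ncls; apply: nex.
    by exists x.
  by apply: finite_image; apply: finite_finset.
exists x; split=> [[[|i] /= ilt]|c]; first exact: Vx.
  exact: (Vs (Ordinal (ilt : (i < size s)%N))).
rewrite big_ord_recl /=; set S := \sum_(i < _) _ => cxS.
have [pc|/bezout_prime[u [v E]]] := boolP (p%:Z %| c ord0)%Z.
  have S1 : val_ge 1 S.
    rewrite -[S](addKr ((c ord0)%:~R * x)); apply/val_geD/cxS/val_geN.
    move/dvdzP: pc => [q ->]; rewrite intrM mulrAC mulrC; apply: p_mul_ideal.
    by rewrite -[0]addr0; apply: val_geM => //; apply: val_ge_int.
  have := free_s _ S1 => pcl i; have [j ->|->//] := unliftP ord0 i.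
  exact: pcl.
(* [c ord0] is invertible modulo [p], which puts the class of [x] in the span. *)
case: ncls.
pose a (i : 'I_(size s)) := - u * c (lift ord0 i).
have p0 : (p%:Z != 0) by rewrite eqz_nat -lt0n prime_gt0.
have am i : (`|(a i %% p%:Z)%Z| < p)%N.
  have := modz_ge0 (a i) p0; have := ltz_pmod (a i) (_ : 0 < p%:Z).
  by rewrite ltz_nat prime_gt0 // => /(_ isT); lia.
exists [ffun i => Ordinal (am i)] => //; apply/residue_classP.
have -> : comb [ffun i => Ordinal (am i)] - x =
   - (u%:~R * ((c ord0)%:~R * x + S)) -
   p%:R * (v%:~R * x + \sum_i (a i %/ p%:Z)%Z%:~R * s`_i).
  have combE : comb [ffun i => Ordinal (am i)] +
      p%:R * \sum_i (a i %/ p%:Z)%Z%:~R * s`_i = - u%:~R * S.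
    rewrite /comb !mulr_sumr -big_split /=; apply: eq_bigr => i _.
    rewrite ffunE /= !mulrA -mulrDl; congr (_ * _).
    rewrite -mulrNz -intrM -/(a i) [in RHS](divz_eq (a i) p%:Z) intrD intrM.
    have -> : `|(a i %% p%:Z)%Z|%:R = (a i %% p%:Z)%Z%:~R :> L.
      by rewrite pmulrn gez0_abs ?modz_ge0.
    by rewrite addrC [X in X + _]mulrC.
  have xE : x = u%:~R * (c ord0)%:~R * x + v%:~R * p%:R * x.
    by rewrite -mulrDl pmulrn -!intrM -intrD E mul1r.
  move: combE => /(canRL (addrK _)) ->.
  by rewrite {1}xE; ring.
apply: val_geB.
  apply: val_geN; rewrite -[1]add0r; apply: val_geM => //; exact: val_ge_int.
apply: p_mul_ideal; apply: val_geD.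
  by rewrite -[0]addr0; apply: val_geM => //; apply: val_ge_int.
apply: val_ge_sum => i _; rewrite -[0]addr0; apply: val_geM => //.
exact: val_ge_int.
Qed.

(** An infinite residue field would contain more independent classes over [Z/p]
    than the degree of [L], and these lift to independent elements of [L]. *)
Lemma finite_residue : finite_set [set residue_class w x | x in valuation_ring w].
Proof.
apply: contrapT => inf.
have [s szs /residue_free_free] : exists2 s, size s = (\dim {:L}).+1 & residue_free s.
  elim: (\dim {:L}).+1 => [|n [s szs /residue_free_extend/(_ inf)[x fx]]].
    by exists [::] => //; split=> [[]|c _ []].
  by exists (x :: s); rewrite //= szs.
rewrite /free szs => /eqP dimE.
have := dimvS (subvf (span s)); by rewrite dimE ltnn.
Qed.

(** The integers below [p] have distinct residue classes. *)
Lemma residue_card_ge : (p <= residue_card w)%N.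
Proof.
pose X := [set residue_class w (i%:R) | i in `I_p].
have inj_cls : {in `I_p &, injective (fun i : nat => residue_class w i%:R)}.
  move=> i j; rewrite !inE => ip jp ij.
  wlog le_ij : i j ip jp ij / (i <= j)%N.
    move=> IH; have [|/ltnW] := leqP i j; first exact: IH.
    by move=> le_ji; apply/esym; apply: IH.
  move/esym/residue_classP: ij; rewrite -natrB // pmulrn => /int_in_ideal.
  rewrite dvdzE /= => pij.
  have : (0 < j - i)%N -> (p <= j - i)%N by move=> ?; apply: dvdn_leq.
  by move: jp => /=; lia.
have cardX : #|` fset_set X|%fset = p.
  by apply: card_fset_set; apply: inj_card_eq.
rewrite -[leqLHS]cardX; apply: fsubset_leq_card; rewrite -fset_set_sub.
- by move=> _ [i _ <-]; exists i%:R => //; apply: val_ge_nat.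
- by apply: finite_image; apply: finite_II.
- exact: finite_residue.
Qed.

End ResidueCharacteristic.

Lemma pole_bounds_norm (R : realType) x : w x < 0 ->
  exists2 p, prime p & 0 < w p%:R /\
    p%:R ^+ `|w x|%N <= Num.max 1 (finite_place_norm R w x).
Proof.
move=> wx; have [p pr_p wp] := place_prime; exists p => //; split=> //.
have x0 : x != 0 by apply: contraTneq wx => ->; rewrite (finite_place0 w_place).
rewrite /finite_place_norm (negPf x0) le_max; apply/orP; right.
have -> : - w x = `|w x|%N by lia.
by rewrite -exprnP lerXn2r ?nnegrE // ler_nat residue_card_ge.
Qed.

End Residue.

(** * Northcott's theorem *)

Section HeightTerms.
Variable R : realType.

Lemma log_plus_ge0 (t : R) : 0 <= log_plus t.
Proof. by rewrite ln_ge0 // le_max lexx. Qed.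

Lemma log_plus_le (t c : R) : log_plus t <= c -> Num.max 1 t <= expR c.
Proof.
rewrite -ler_expR lnK //.
by rewrite posrE (lt_le_trans ltr01) // le_max lexx.
Qed.

Lemma esum_term (T : choiceType) (I : set T) (a : T -> \bar R) i :
  (forall j, (0 <= a j)%E) -> I i -> (a i <= \esum_(j in I) a j)%E.
Proof.
move=> a0 Ii; apply: esum_ge; exists [set i]; last by rewrite fsbig_set1.
by split; [exact: finite_set1|move=> _ ->].
Qed.

(** All terms of the height are nonnegative, so each is bounded by the whole. *)
Lemma field_height_terms (L : fieldExtType rat) (x : L) (c : R) :
  (field_height R x < c%:E)%E ->
  (forall s, complex_embedding s ->
     log_plus (Normc.normc (s x) : R) <= (\dim {:L})%:R * c) /\
  (forall w, finite_place w ->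
     log_plus (finite_place_norm R w x) <= (\dim {:L})%:R * c).
Proof.
have d0 : 0 < (\dim {:L})%:R :> R by rewrite ltr0n adim_gt0.
rewrite /field_height; set S1 := esum _ _; set S2 := esum _ _ => hc.
have S1_ge0 : (0 <= S1)%E by apply: esum_ge0 => s _; rewrite lee_fin log_plus_ge0.
have S2_ge0 : (0 <= S2)%E by apply: esum_ge0 => s _; rewrite lee_fin log_plus_ge0.
have {}hc : (S1 + S2 <= ((\dim {:L})%:R * c)%:E)%E.
  move: hc; rewrite lte_pdivrMl // => /ltW.
  by rewrite EFinM.
split=> [s hs|w hw]; rewrite -lee_fin; apply: le_trans hc.
  apply: le_trans (leeDl _ S2_ge0).
  by apply: (@esum_term _ _ (fun s => (log_plus (Normc.normc (s x)))%:E)) => // j;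
    rewrite lee_fin log_plus_ge0.
apply: le_trans (leeDr _ S1_ge0).
by apply: (@esum_term _ _ (fun w => (log_plus (finite_place_norm R w x))%:E)) => // j;
    rewrite lee_fin log_plus_ge0.
Qed.

End HeightTerms.

(** Send [q(y)] to [q(b)] for each rational polynomial [q]: this is well defined
    because every polynomial that vanishes at [y] vanishes at [b]. *)
Lemma embedding_of_root (L : fieldExtType rat) (E : numFieldType) (y : L) (b : E) :
  <<1; y>>%VS = fullv ->
  (forall q : {poly rat}, root (map_poly (in_alg L) q) y -> root (map_poly ratr q) b) ->
  exists f : {rmorphism L -> E}, f y = b.
Proof.
move=> gen y_b.
have r_ex u : exists q : {poly rat}, (map_poly (in_alg L) q).[y] = u.
  have uK : u \in <<1; y>>%VS by rewrite gen memvf.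
  have /polyOver1P[q qE] := Fadjoin_polyOver 1%AS y u.
  by exists q; rewrite -(Fadjoin_poly_eq (K := 1%AS) uK) qE.
have [r rE] := choice r_ex.
pose f u := (map_poly ratr (r u)).[b].
have fE q : f (map_poly (in_alg L) q).[y] = (map_poly ratr q).[b].
  apply/eqP; rewrite -subr_eq0 -hornerN -hornerD -rmorphB; apply: y_b.
  by rewrite /root rmorphB hornerD hornerN rE subrr.
have fB : zmod_morphism f.
  by move=> u v; rewrite -(rE u) -(rE v) -hornerN -hornerD -rmorphB !fE rmorphB hornerD hornerN.
have fM : monoid_morphism f.
  split=> [|u v]; first by have := fE 1; rewrite !rmorph1 !hornerC.
  by rewrite -(rE u) -(rE v) -hornerM -rmorphM !fE rmorphM hornerM.
pose fB' := GRing.isZmodMorphism.Build L E f fB.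
pose fM' := GRing.isMonoidMorphism.Build L E f fM.
pose F : {rmorphism L -> E} := HB.pack f fB' fM'.
by exists F; have := fE 'X; rewrite !map_polyX !hornerX.
Qed.

Lemma coef_prod_XsubC_le (E : numDomainType) (s : seq E) (M : nat) :
  (forall z, z \in s -> `|z| <= M%:R) ->
  forall i, `|(\prod_(z <- s) ('X - z%:P))`_i| <= ((1 + M) ^ size s)%:R.
Proof.
elim: s => [|z s IHs] sM i.
  by rewrite big_nil expn0 coef1; case: eqP; rewrite ?normr1 ?normr0.
have {}IHs : forall i, `|(\prod_(z <- s) ('X - z%:P))`_i| <= ((1 + M) ^ size s)%:R.
  by apply: IHs => u us; apply: sM; rewrite inE us orbT.
rewrite big_cons mulrBl coefB coefXM coefCM /= expnS mulnDl mul1n natrD natrM.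
apply: le_trans (ler_normB _ _) _; apply: lerD.
  by case: eqP => _; rewrite ?normr0.
by rewrite normrM ler_pM // sM ?inE ?eqxx.
Qed.

(** The polynomials are coded by finite functions, a coefficient [c] of
    absolute value at most [H] by the natural number [c + H]. *)
Lemma finite_roots_bounded n H :
  finite_set [set a : algC | exists p : {poly int},
    [/\ p != 0, (size p <= n)%N, (forall i, `|p`_i| <= H%:Z) & root (map_poly intr p) a]].
Proof.
pose P (g : {ffun 'I_n -> 'I_(H.*2).+1}) : {poly int} :=
  \poly_(i < n) (oapp (fun j => (g j)%:Z - H%:Z) 0 (insub i)).
pose Z g := [set a : algC | P g != 0 /\ root (map_poly intr (P g)) a].
apply: (@sub_finite_set _ _ (\bigcup_(g in [set: {ffun 'I_n -> 'I_(H.*2).+1}]) Z g)).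
  move=> a [p [p0 szp pH pa]].
  have gP (i : 'I_n) : (`|(p`_i + H%:Z)%R| < (H.*2).+1)%N by have := pH i; lia.
  exists [ffun i => Ordinal (gP i)] => //.
  suff PE : P [ffun i => Ordinal (gP i)] = p by split; rewrite PE.
  apply/polyP => i; rewrite coef_poly; case: ifP => [ilt|/negbT].
    rewrite insubT /= ffunE /=; have := pH i; rewrite ler_norml => /andP[pl _].
    by rewrite gez0_abs ?addrK // -lerBlDr sub0r.
  by rewrite -leqNgt => ni; rewrite nth_default // (leq_trans szp).
apply: bigcup_finite; first exact: finite_finset.
move=> g _; have [P0|P0] := eqVneq (P g) 0.
  by rewrite /Z P0; apply: (@sub_finite_set _ _ set0) => // a []; rewrite eqxx.
have [r rE] := closed_field_poly_normal (map_poly intr (P g) : {poly algC}).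
apply: (@sub_finite_set _ _ [set` r]); last exact: finite_seq.
move=> a [_]; rewrite rE rootZ ?root_prod_XsubC //.
by rewrite lead_coef_eq0 map_poly_eq0_id0 // intr_eq0 lead_coef_eq0.
Qed.

Lemma dim_le_size (L : fieldExtType rat) (x : L) (q : {poly rat}) :
  <<1; x>>%VS = fullv -> q != 0 -> root (map_poly (in_alg L) q) x ->
  (\dim {:L} < size q)%N.
Proof.
move=> gen q0 qx; have := dim_Fadjoin 1%AS x; rewrite gen dimv1 muln1 => ->.
rewrite -(size_minPoly 1%AS x) -(size_map_poly (in_alg L)).
apply: dvdp_leq; first by rewrite map_poly_eq0.
by apply: minPoly_dvdp => //; apply/polyOver1P; exists q.
Qed.

Section Northcott.
Variable R : realType.

Definition degree_le (D : nat) (a : algC) : Prop :=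
  exists q : {poly rat}, [/\ q != 0, (size q <= D.+1)%N & root (map_poly ratr q) a].

(** At a pole [w] of [x] above a prime [p], the bound gives [p ^ j <= B] for the
    pole order [j].  Hence [j <= B] and [p] divides [B`!], so [B`! ^ B] vanishes at
    [w] to order at least [j]. *)
Lemma common_denominator (L : fieldExtType rat) (x : L) (B : nat) :
  (forall w, finite_place w -> Num.max 1 (finite_place_norm R w x) <= B%:R) ->
  exists2 q : {poly int}, q \is monic & root (map_poly intr q) ((B`! ^ B)%:R * x).
Proof.
move=> xB; apply: contrapT => nex.
have [q mon_q|w w_place] := @exists_negative_place L ((B`! ^ B)%:R * x).
  by apply/negP => qx; apply: nex; exists q.
have b0 : (B`! ^ B)%:R != 0 :> L by rewrite natr_ext_eq0 -lt0n expn_gt0 fact_gt0.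
have wn := place_nat_ge0 w_place.
have [->|x0] := eqVneq x 0; first by rewrite mulr0 (finite_place0 w_place).
rewrite (finite_placeM w_place) //; have [wx|wx] := ltP (w x) 0; last first.
  by rewrite ltNge addr_ge0.
have [p pr_p [wp norm_p]] := pole_bounds_norm w_place R wx.
have {norm_p} : (p ^ `|w x| <= B)%N.
  by rewrite -(ler_nat R) natrX; apply: le_trans norm_p (xB w w_place).
set j := `|w x|%N => pjB.
have p1 := prime_gt1 pr_p.
have jB : (j <= B)%N by apply: leq_trans pjB; apply/ltnW/ltn_expl.
have pB : (p <= B)%N.
  apply: leq_trans pjB; rewrite -{1}[p]expn1 leq_pexp2l ?(ltnW p1) //.
  by rewrite /j absz_gt0; lia.
have /dvdnP[m mE] : (p %| B`!)%N by rewrite dvdn_fact // prime_gt0.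
have fact_neq0 : B`!%:R != 0 :> L by rewrite natr_ext_eq0 -lt0n fact_gt0.
have wfact : 1 <= w B`!%:R.
  move: (fact_neq0); rewrite mE natrM mulf_eq0 negb_or => /andP[m0 p0].
  by rewrite (finite_placeM w_place) //; have := wn m; lia.
rewrite natrX (placeX w_place) //; move: jB; rewrite /j; nia.
Qed.

(** Bounded height bounds the conjugates of [a] and, by [common_denominator],
    yields an integer [b], the same for all [a], such that [b * a] is an algebraic
    integer.  Each complex root of the minimal polynomial of [b * a] is the image
    of [b * a] under an embedding, so the coefficients of this polynomial are
    bounded. *)
Theorem northcott_finite D (T : R) :
  finite_set [set a : algC | degree_le D a /\ (weil_height R a < T%:E)%E].
Proof.
pose e := expR (D%:R * `|T|).
pose B := Num.Def.archi_bound e.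
have eB : e <= B%:R by apply/ltW/archi_boundP/expR_ge0.
(* [M] bounds the conjugates of [b * a], and [H] their symmetric functions. *)
pose b := (B`! ^ B)%N; pose M := (b * B)%N; pose H := ((1 + M) ^ D)%N.
have b0 : (0 < b)%N by rewrite expn_gt0 fact_gt0.
have := finite_roots_bounded D.+1 H => /(finite_image (fun z : algC => z / b%:R)).
apply: sub_finite_set => a [[q [q0 szq qa]]]; rewrite /weil_height.
case: (num_field_exists _) => L [QsC [s sE gen]].
case: s sE gen => [//|x [|//]] /= [aE].
rewrite -{a}aE in qa *; rewrite adjoin_seq1 => gen /field_height_terms[xinf xfin].
have QsC_rat q' z : root (map_poly ratr q') (QsC z) = root (map_poly (in_alg L) q') z.
  rewrite -(fmorph_root QsC) -map_poly_comp; congr (root _ _).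
  by apply: eq_map_poly => r; rewrite -(fmorph_eq_rat (QsC \o in_alg L)).
have dD : (\dim {:L} <= D)%N.
  by rewrite -ltnS; apply: leq_trans szq; apply: (dim_le_size gen) => //; rewrite -QsC_rat.
have d_e : expR ((\dim {:L})%:R * T) <= e.
  rewrite ler_expR; apply: le_trans (_ : (\dim {:L})%:R * `|T| <= _).
    by rewrite ler_wpM2l // ler_norm.
  by rewrite ler_wpM2r // ler_nat.
have xB w : finite_place w -> Num.max 1 (finite_place_norm R w x) <= B%:R.
  move=> hw; apply: le_trans eB; apply: le_trans d_e.
  exact/log_plus_le/xfin.
have xBi s : complex_embedding s -> Normc.normc (s x : R[i]) <= B%:R.
  move=> hs; apply: le_trans eB; apply: le_trans d_e.
  by apply: le_trans (log_plus_le (xinf s hs)); rewrite le_max lexx orbT.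
have [Q mon_Q Qy] := common_denominator xB; rewrite -/b in Qy.
set y := b%:R * x in Qy.
have yA : QsC y \in Aint.
  apply: (@root_monic_Aint (map_poly intr Q)).
  - rewrite (_ : map_poly intr Q = map_poly QsC (map_poly intr Q)) ?fmorph_root //.
    by rewrite -map_poly_comp; apply: eq_map_poly => r /=; rewrite rmorph_int.
  - exact: monic_map.
  - by apply/polyOverP => i; rewrite coef_map /= intr_int.
have bL0 : b%:R != 0 :> L by rewrite natr_ext_eq0 -lt0n.
have geny : <<1; y>>%VS = fullv.
  apply/eqP; rewrite eqEsubv subvf -gen; apply/FadjoinP; split; first exact: sub1v.
  have -> : x = b%:R^-1 * y by rewrite mulKf.
  by rewrite rpredM ?memv_adjoin // rpredV rpred_nat.
have [p [pE mon_p p_dvd]] := minCpolyP (QsC y).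
have [P PE] := floorpP yA.
have pPE : p = map_poly intr P.
  apply: (map_poly_inj (ratr : rat -> algC)); rewrite -pE PE -map_poly_comp.
  by apply: eq_map_poly => r /=; rewrite ratr_int.
have p0 : p != 0 := monic_neq0 mon_p.
have szp : (size p <= D.+1)%N.
  apply: leq_trans (_ : (\dim {:L}).+1 <= _)%N; last by rewrite ltnS.
  have [c [[i0 i0d ci0] cy]] := rat_relation y.
  pose C := \poly_(i < (\dim {:L}).+1) c i.
  have C0 : C != 0.
    apply: contraNneq ci0 => C0; have := coef_poly (\dim {:L}).+1 c i0.
    by rewrite -/C C0 coef0 ltnS i0d => <-.
  apply: leq_trans (size_poly _ c); apply: dvdp_leq => //; rewrite -p_dvd QsC_rat.
  rewrite /root (@horner_coef_wide _ (\dim {:L}).+1); last first.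
    by rewrite (leq_trans (size_poly _ _)) // size_poly.
  rewrite -[X in _ == X]cy; apply/eqP; apply: eq_bigr => i _.
  by rewrite coef_map coef_poly ltn_ord.
exists (QsC y); last by rewrite rmorphM rmorph_nat mulrAC mulfV ?mul1r // pnatr_eq0 -lt0n.
exists P; split.
- by apply: contraNneq p0; rewrite pPE => ->; rewrite rmorph0.
- by rewrite pPE size_map_inj_poly // in szp; apply: intr_inj.
- move=> i; pose PC : {poly R[i]} := map_poly intr P.
  have PCE : PC = map_poly ratr p.
    by rewrite pPE -map_poly_comp; apply: eq_map_poly => r /=; rewrite ratr_int.
  have mon_PC : PC \is monic by rewrite PCE map_monic.
  have [r rE] := closed_field_poly_normal PC.
  rewrite (monicP mon_PC) scale1r in rE.
  have rM z : z \in r -> `|z| <= M%:R.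
    move=> zr; have PCz : root PC z by rewrite rE root_prod_XsubC.
    have [q' /[!(=^~ QsC_rat)] q'y|f fy] := @embedding_of_root L R[i] y z geny.
      move: q'y; rewrite p_dvd => /dvdpP[u ->].
      rewrite PCE in PCz; rewrite rmorphM rootM; apply/orP; right; exact: PCz.
    have fx : Normc.normc (f x) <= B%:R by apply: xBi; exists f.
    rewrite -fy rmorphM rmorph_nat normrM normr_nat /M natrM ler_wpM2l //.
    have -> : `|f x| = ((Normc.normc (f x))%:C)%C by [].
    by rewrite -(rmorph_nat (real_complex R)) lecR.
  have := coef_prod_XsubC_le rM i; rewrite -rE coef_map /=.
  rewrite -intr_norm => hi.
  have {hi} : `|P`_i| <= ((1 + M) ^ size r)%:Z by rewrite -(ler_int R[i]).
  have szr : (size r <= D)%N.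
    have := szp; rewrite -(size_map_poly (ratr : {rmorphism rat -> R[i]})) -PCE rE.
    by rewrite size_prod_XsubC.
  move/le_trans; apply; rewrite lez_nat; apply: leq_pexp2l => //.
- by rewrite -PE root_minCpoly.
Qed.

End Northcott.

(** * Quadratic extensions *)

Lemma subfieldP (F : set algC) : subfield_of_algC F <->
  [/\ F 1, forall x y, F x -> F y -> F (x - y) & forall x y, F x -> F y -> F (x / y)].
Proof.
split=> [[F1 FB FV]|[F1 FB FV]]; split.
- by move: F1; rewrite inE.
- by move=> x y Fx Fy; have := FB x y; rewrite !inE; apply.
- by move=> x y Fx Fy; have := FV x y; rewrite !inE; apply.
- by rewrite inE.
- by move=> x y; rewrite !inE; apply: FB.
- by move=> x y; rewrite !inE; apply: FV.
Qed.

Section Subfield.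
Variable F : set algC.
Hypothesis subF : subfield_of_algC F.

Lemma subfield1 : F 1. Proof. by case/subfieldP: subF. Qed.

Lemma subfieldB x y : F x -> F y -> F (x - y).
Proof. by case/subfieldP: subF => _ + _; apply. Qed.

Lemma subfield_div x y : F x -> F y -> F (x / y).
Proof. by case/subfieldP: subF => _ _; apply. Qed.

Lemma subfield0 : F 0.
Proof. by rewrite -(subrr 1); apply: subfieldB; apply: subfield1. Qed.

Lemma subfieldV x : F x -> F x^-1.
Proof. by rewrite -[x^-1]mul1r; apply/subfield_div/subfield1. Qed.

Lemma subfieldM x y : F x -> F y -> F (x * y).
Proof. by move=> Fx Fy; rewrite -[y]invrK; apply/subfield_div/subfieldV. Qed.

Lemma subfield_subring : subring_set F.
Proof. by split; [exact: subfield1|exact: subfieldB|exact: subfieldM]. Qed.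

Lemma subfieldD x y : F x -> F y -> F (x + y).
Proof. exact: (subringD subfield_subring). Qed.

Lemma subfield_rat r : F (ratr r).
Proof.
by apply: subfield_div; apply: (subring_int subfield_subring).
Qed.

Lemma Crat_span_sub s : (forall x, x \in s -> F x) -> [set` Crat_span s] `<=` F.
Proof.
move=> sF _ /Crat_spanP[a ->]; apply: (subring_sum subfield_subring) => i _.
by apply: subfieldM; [apply: subfield_rat | apply/sF/mem_nth].
Qed.

End Subfield.

Definition quadratic (K : set algC) (t : algC) : set algC :=
  [set x | exists a b, [/\ K a, K b & x = a + b * t]].

Section Quadratic.
Variables (K : set algC) (t : algC).
Hypothesis subK : subfield_of_algC K.

Lemma quadratic_sub : K `<=` quadratic K t.
Proof.
by move=> x Kx; exists x, 0; rewrite mul0r addr0; split=> //; apply: subfield0.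
Qed.

Lemma quadratic_gen : quadratic K t t.
Proof.
by exists 0, 1; rewrite mul1r add0r; split=> //; [apply: subfield0|apply: subfield1].
Qed.

Lemma quadratic_subfield : K (t ^+ 2) -> ~ K t -> subfield_of_algC (quadratic K t).
Proof.
move=> Kt2 Kt; apply/subfieldP; split.
- by apply: quadratic_sub; apply: subfield1.
- move=> _ _ [a [b [Ka Kb ->]]] [c [e [Kc Ke ->]]].
  by exists (a - c), (b - e); split; [exact: subfieldB|exact: subfieldB|ring].
- move=> _ _ [a [b [Ka Kb ->]]] [c [e [Kc Ke ->]]].
  have [->|n0] := eqVneq (c + e * t) 0.
    by rewrite invr0 mulr0; apply: quadratic_sub; apply: subfield0.
  have n'0 : c - e * t != 0.
    apply: contraPneq Kt => /eqP; rewrite subr_eq0 => /eqP cE; apply.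
    have [e0|e0] := eqVneq e 0.
      by move: n0; rewrite cE e0 mul0r addr0 eqxx.
    have -> : t = c / e by rewrite cE mulrAC mulfV ?mul1r.
    exact: subfield_div.
  pose n := c ^+ 2 - e ^+ 2 * t ^+ 2.
  have nE : n = (c + e * t) * (c - e * t) by rewrite /n; ring.
  have X k := subringX (subfield_subring subK) k.
  have Kn : K n by apply: (subfieldB subK); [exact: X|apply: (subfieldM subK) => //; exact: X].
  exists ((a * c - b * e * t ^+ 2) / n), ((b * c - a * e) / n); split.
  + apply: subfield_div => //; apply: subfieldB => //;
      by do ?[assumption | apply: (subfieldM subK)].
  + apply: subfield_div => //; apply: subfieldB => //;
      by do ?[assumption | apply: (subfieldM subK)].
  + by rewrite nE; field; rewrite n0 n'0.
Qed.

Lemma quadratic_span s : K = [set` Crat_span s] -> K (t ^+ 2) -> ~ K t ->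
  quadratic K t = [set` Crat_span (s ++ [seq x * t | x <- s])].
Proof.
move=> KE Kt2 Kt; have subKt := quadratic_subfield Kt2 Kt.
apply/seteqP; split=> [_ [a [b [Ka Kb ->]]]|].
  set s' := s ++ _.
  have span_sum (c : algC) u : (forall x, x \in s -> x * c \in s') -> K u ->
      u * c \in Crat_span s'.
    rewrite KE => sc /Crat_spanP[v ->]; rewrite mulr_suml; apply: rpred_sum => i _.
    by rewrite -mulrA; apply/Crat_spanZ/mem_Crat_span/sc/mem_nth.
  apply: rpredD; last first.
    by apply: span_sum => // x xs; rewrite mem_cat (map_f (fun x => x * t)) ?orbT.
  by rewrite -[a]mulr1; apply: span_sum => // x xs; rewrite mulr1 mem_cat xs.
apply: (Crat_span_sub subKt) => x; rewrite mem_cat => /orP[xs|/mapP[z zs ->]].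
  by apply: quadratic_sub; rewrite KE; apply: mem_Crat_span.
apply: (subfieldM subKt); last exact: quadratic_gen.
by apply: quadratic_sub; rewrite KE; apply: mem_Crat_span.
Qed.

End Quadratic.

(** * Square roots of primes *)

Fixpoint sqrt_field (ps : seq nat) : set algC :=
  if ps is p :: ps' then quadratic (sqrt_field ps') (sqrtC p%:R) else [set` Crat].

Lemma sqrt_notin_rat l q : (0 < q)%N -> prime l -> odd (logn l q) ->
  sqrtC q%:R \notin Crat.
Proof.
move=> q0 pr_l; apply: contraL => /CratP[r rE].
have : r ^+ 2 = q%:R.
  apply: (fmorph_inj (ratr : {rmorphism rat -> algC})).
  by rewrite rmorphXn rmorph_nat /= -rE sqrtCK.
rewrite -{1}[r]divq_num_den expr_div_n => /(canRL (divfK _)) E.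
have {}E : (`|numq r| ^ 2 = q * `|denq r| ^ 2)%N.
  apply/eqP; rewrite -(eqr_nat rat) natrM !natrX; apply/eqP.
  have -> : `|denq r|%:R = (denq r)%:~R :> rat by rewrite pmulrn gez0_abs ?denq_ge0.
  rewrite -E; last by rewrite expf_neq0 ?intr_eq0 ?denq_eq0.
  by rewrite natr_absz intr_norm real_normK ?num_real.
have d0 : (0 < `|denq r|)%N by rewrite absz_gt0 denq_eq0.
move/(congr1 (logn l)): E; rewrite lognX lognM ?expn_gt0 ?d0 // lognX.
by move=> /(congr1 odd); rewrite oddD !oddM /= addbF => <-.
Qed.

(** Adjoining one more square root never captures the square root of an integer
    with an odd exponent at a further prime: if [sqrt q = a + b * sqrt p], then
    squaring shows that [sqrt p], [sqrt q] or [sqrt (q * p)] lies in the smaller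
    field. *)
Lemma sqrt_fieldP ps : all prime ps -> uniq ps ->
  subfield_of_algC (sqrt_field ps) /\
  forall q l, (0 < q)%N -> prime l -> l \notin ps -> odd (logn l q) ->
    ~ sqrt_field ps (sqrtC q%:R).
Proof.
elim: ps => [_ _|p ps IHps /= /andP[pr_p pr_ps] /andP[p_ps uniq_ps]].
  split=> [|q l q0 pr_l _ odd_q]; last exact/negP/(sqrt_notin_rat q0 pr_l).
  apply/subfieldP; split=> /= [|x y|x y]; [exact: rpred1|exact: rpredB|exact: rpred_div].
have [subF sqF] := IHps pr_ps uniq_ps; set F := sqrt_field ps in subF sqF *.
have p0 := prime_gt0 pr_p.
have Fp : ~ F (sqrtC p%:R) by apply: (sqF p p) => //; rewrite (pfactorK 1).
have Fnat n : F n%:R := subring_nat (subfield_subring subF) n.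
split; first by apply: quadratic_subfield; rewrite ?sqrtCK.
move=> q l q0 pr_l; rewrite inE negb_or => /andP[lp l_ps] odd_q.
move=> [a [b [Fa Fb qE]]].
have q2 : q%:R = a ^+ 2 + b ^+ 2 * p%:R + 2%:R * a * b * sqrtC p%:R :> algC.
  by rewrite -[q%:R]sqrtCK qE -[p%:R in X in _ = _ + X + _]sqrtCK; ring.
have X2 x : F x -> F (x ^+ 2) by apply: (subringX (subfield_subring subF)).
have [b0|b0] := eqVneq b 0.
  by apply: (sqF q l) => //; rewrite qE b0 mul0r addr0.
have [a0|a0] := eqVneq a 0.
  apply: (sqF (q * p)%N l) => //; rewrite ?muln_gt0 ?q0 //.
    by rewrite lognM // oddD odd_q logn_prime // (negPf lp).
  rewrite natrM rootCMl ?ler0n // qE a0 add0r -mulrA -expr2 sqrtCK; exact: (subfieldM subF).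
apply: Fp; have ab0 : 2%:R * a * b != 0 by rewrite !mulf_neq0 ?pnatr_eq0.
have -> : sqrtC p%:R = (q%:R - (a ^+ 2 + b ^+ 2 * p%:R)) / (2%:R * a * b).
  by rewrite q2 addrC addKr mulrC mulKf.
apply: subfield_div => //; last by do ![apply: (subfieldM subF) => //]; exact: Fnat.
apply: subfieldB => //; apply: subfieldD => //; first exact: X2.
by apply: (subfieldM subF) => //; exact: X2.
Qed.

(** By [sqrt_fieldP] each square root lies outside the field generated by the
    others that follow it, in particular outside their span. *)
Lemma sqrt_span_free (L : fieldExtType rat) (QsC : {rmorphism L -> algC}) ps s :
  all prime ps -> uniq ps -> map QsC s = [seq sqrtC p%:R | p <- ps] ->
  (forall u, u \in span s -> sqrt_field ps (QsC u)) /\ free s.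
Proof.
elim: ps s => [|p ps IHps] [|x s] //= pr_ps uniq_ps sE.
  split; last by rewrite nil_free.
  by move=> u; rewrite span_nil memv0 => /eqP->; rewrite rmorph0; apply: rpred0.
case: sE => xE sE; case/andP: (pr_ps) => pr_p pr_ps'; case/andP: (uniq_ps) => p_ps uniq_ps'.
have [spanF free_s] := IHps s pr_ps' uniq_ps' sE.
have [subF sqF] := sqrt_fieldP pr_ps' uniq_ps'.
split.
  move=> u; rewrite span_cons => /memv_addP[v /vlineP[k ->] [z zs ->]].
  exists (QsC z), (ratr k); split; [exact: spanF|exact: subfield_rat|].
  by rewrite rmorphD addrC -mulr_algl rmorphM -xE -(fmorph_eq_rat (QsC \o in_alg L)).
rewrite free_cons free_s andbT; apply/negP => /spanF; rewrite xE.
by apply: (sqF p p) => //; rewrite ?prime_gt0 // (pfactorK 1).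
Qed.

(** A number field cannot contain more independent square roots than its degree. *)
Lemma exists_sqrt_notin (L : fieldExtType rat) (QsC : {rmorphism L -> algC}) :
  exists2 p, prime p & forall x, QsC x <> sqrtC p%:R.
Proof.
apply: contrapT => nex.
have x_ex p : exists x, prime p -> QsC x = sqrtC p%:R.
  have [pr_p|npr] := boolP (prime p); last by exists 0.
  apply: contrapT => nx; apply: nex; exists p => // x xE.
  by apply: nx; exists x.
have [x xE] := choice x_ex.
have [ps [szps pr_ps uniq_ps]] : exists ps, [/\ size ps = (\dim {:L}).+1, all prime ps & uniq ps].
  elim: (\dim {:L}).+1 => [|n [ps [szps pr_ps uniq_ps]]]; first by exists [::].
  have [p p_ps pr_p] := prime_above (\max_(q <- ps) q).
  exists (p :: ps); rewrite /= szps pr_p pr_ps uniq_ps !andbT; split=> //.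
  by apply: contraL p_ps => p_ps; rewrite -leqNgt (big_rem p) //= leq_maxl.
have [|_] := @sqrt_span_free L QsC ps (map x ps) pr_ps uniq_ps.
  by rewrite -map_comp; apply/eq_in_map => p /(allP pr_ps) /xE.
rewrite /free size_map szps => /eqP dimE.
by have := dimvS (subvf (span (map x ps))); rewrite dimE ltnn.
Qed.

(** Take for [t] the square root of a prime outside the number field generated by
    [K] and [E]: an element [a + b * t] of [E] has [b != 0], and solving for [t]
    gives a contradiction. *)
Lemma quadratic_avoiding (K : set algC) s (E : seq algC) :
  subfield_of_algC K -> K = [set` Crat_span s] -> (forall e, e \in E -> ~ K e) ->
  exists t, [/\ K (t ^+ 2), ~ K t & forall e, e \in E -> ~ quadratic K t e].
Proof.
move=> subK KE EK.
have [L [QsC [s1 s1E _]]] := num_field_exists (s ++ E).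
have [p pr_p pL] := exists_sqrt_notin QsC.
pose F := range QsC.
have subF : subfield_of_algC F.
  apply/subfieldP; split=> [|_ _ [x _ <-] [y _ <-]|_ _ [x _ <-] [y _ <-]].
  - by exists 1; rewrite ?rmorph1.
  - by exists (x - y); rewrite ?rmorphB.
  - by exists (x / y); rewrite ?fmorph_div.
have sF x : x \in s ++ E -> F x.
  by rewrite -s1E => /mapP[z _ ->]; exists z.
have KF : K `<=` F.
  by rewrite KE; apply: (Crat_span_sub subF) => x xs; apply: sF; rewrite mem_cat xs.
have Ft : ~ F (sqrtC p%:R) by case=> x _; apply: pL.
exists (sqrtC p%:R); split.
- by rewrite sqrtCK; apply: (subring_nat (subfield_subring subK)).
- by move/KF.
- move=> e eE [a [b [Ka Kb eab]]]; have [b0|b0] := eqVneq b 0.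
    by apply: (EK e eE); rewrite eab b0 mul0r addr0.
  apply: Ft; have -> : sqrtC p%:R = (e - a) / b by rewrite eab addrC addKr mulrC mulKf.
  apply: (subfield_div subF); last exact: KF.
  apply: (subfieldB subF); last exact: KF.
  by apply: sF; rewrite mem_cat eE orbT.
Qed.

(** The [size s + 1] first powers of [x] are linearly dependent over the rationals. *)
Lemma span_degree_le (K : set algC) s x :
  subfield_of_algC K -> K = [set` Crat_span s] -> K x -> degree_le (size s) x.
Proof.
move=> subK KE Kx; set n := size s.
have pow_ex (j : 'I_n.+1) : exists a : 'rV[rat]_n, x ^+ j = \sum_i ratr (a 0 i) * s`_i.
  have : K (x ^+ j) by apply: (subringX (subfield_subring subK)).
  rewrite KE => /Crat_spanP[a ->]; exists (\row_i a i).
  by apply: eq_bigr => i _; rewrite mxE.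
have [A AE] := choice pow_ex.
pose M := \matrix_(j < n.+1) A j.
have : kermx M != 0.
  rewrite kermx_eq0 /row_free neq_ltn (leq_ltn_trans (rank_leq_col M)) //.
move=> /rowV0Pn[v /sub_kermxP vM v0].
pose q := \poly_(j < n.+1) v 0 (inord j).
exists q; split; [|exact: size_poly|].
  apply: contraNneq v0 => q0; apply/eqP/rowP => j; rewrite mxE.
  by have := coef_poly n.+1 (fun j => v 0 (inord j)) j; rewrite -/q q0 coef0 ltn_ord inord_val.
rewrite /root (@horner_coef_wide _ n.+1); last first.
  by rewrite (leq_trans (size_poly _ _)) // size_poly.
under eq_bigr do rewrite coef_map coef_poly ltn_ord inord_val AE mulr_sumr.
rewrite exchange_big big1 //= => i _.
have := congr1 (fun u : 'rV_n => ratr (u 0 i) : algC) vM; rewrite !mxE rmorph0 rmorph_sum => vMi.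
transitivity ((0 : algC) * s`_i); last by rewrite mul0r.
rewrite -[X in _ = X * _]vMi mulr_suml; apply: eq_bigr => j _.
by rewrite rmorphM mxE mulrA.
Qed.

(** * Towers avoiding small heights and given fields *)

Section Tower.
Variables (R : realType) (T : R) (G : nat -> set algC).

(** The components are a number field, a spanning sequence of it, and a finite
    set of numbers that all later stages must avoid. *)
Definition stage := (set algC * seq algC * seq algC)%type.

Definition stage_ok (S : stage) : Prop :=
  [/\ subfield_of_algC S.1.1, S.1.1 = [set` Crat_span S.1.2] &
      forall x, x \in S.2 -> ~ S.1.1 x].

(** The last clause is the diagonal step against [G n]: either the growing tower
    outgrows [G n], or a member of [G n] is excluded from it for good. *)
Definition stage_step (n : nat) (S S' : stage) : Prop :=
  [/\ S.1.1 `<=` S'.1.1, exists2 x, S'.1.1 x & ~ S.1.1 x,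
      {subset S.2 <= S'.2},
      forall x, S'.1.1 x -> ~ S.1.1 x -> ~ (weil_height R x < T%:E)%E &
      G n `<=` S.1.1 \/ exists2 x, x \in S'.2 & G n x].

(** The elements of a quadratic extension have degree at most [2 * size s], so the
    ones of small height range over a finite set that is known before the
    extension is chosen; the extension then avoids this set outside [K]. *)
Lemma stage_step_exists n S : stage_ok S -> exists S', stage_ok S' /\ stage_step n S S'.
Proof.
case: S => [[K s] E] [/= subK KE EK].
have [E' [EE' E'K GE']] : exists E' : seq algC, [/\ {subset E <= E'},
    forall x, x \in E' -> ~ K x & G n `<=` K \/ exists2 x, x \in E' & G n x].
  have [GK|/existsNP[x /not_implyP[Gx Kx]]] := EM (G n `<=` K).
    by exists E; split=> //; left.
  exists (x :: E); split=> [y yE|y|]; first by rewrite inE yE orbT.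
    by rewrite inE => /predU1P[->//|/EK].
  by right; exists x; rewrite ?mem_head.
have /finite_seqP[N NE] := northcott_finite (size s + size s) T.
pose N' := [seq x <- N | `[< ~ K x >]].
have [t [Kt2 Kt avoid]] : exists t, [/\ K (t ^+ 2), ~ K t &
    forall e, e \in E' ++ N' -> ~ quadratic K t e].
  apply: (quadratic_avoiding subK KE) => e; rewrite mem_cat => /orP[/E'K//|].
  by rewrite mem_filter => /andP[/asboolP].
have subKt := quadratic_subfield subK Kt2 Kt.
have KtE := quadratic_span subK KE Kt2 Kt.
exists (quadratic K t, s ++ [seq x * t | x <- s], E'); split; split=> //=.
- by move=> x xE'; apply: avoid; rewrite mem_cat xE'.
- exact: quadratic_sub.
- by exists t => //; apply: quadratic_gen.
- move=> x Ktx Kx hx; apply: (avoid x) => //.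
  rewrite mem_cat mem_filter; apply/orP; right; apply/andP; split; first exact/asboolP.
  suff : [set` N] x by [].
  rewrite -NE; split=> //; have := span_degree_le subKt KtE Ktx.
  by rewrite size_cat size_map.
Qed.

(** The union of a tower of stages.  An element of small height descends stage by
    stage to [K]. *)
Lemma diagonal_extension (K : set algC) : number_field K ->
  exists F : set algC, [/\ subfield_of_algC F, K `<=` F,
    forall x, F x -> (weil_height R x < T%:E)%E -> K x & forall n, F <> G n].
Proof.
move=> [subK [s KE]].
have next_ex (nS : nat * stage) : exists S',
    stage_ok nS.2 -> stage_ok S' /\ stage_step nS.1 nS.2 S'.
  have [/(stage_step_exists nS.1)[S' S'P]|nok] := EM (stage_ok nS.2); first by exists S'.
  by exists nS.2.
have [next nextP] := choice next_ex.
pose S := fix S n : stage := if n is n'.+1 then next (n', S n') else ((K, s), [::]).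
have S_ok n : stage_ok (S n).
  by elim: n => [|n IHn]; [split | case: (nextP (n, S n) IHn)].
have S_step n : stage_step n (S n) (S n.+1) by case: (nextP (n, S n) (S_ok n)).
pose k n := (S n).1.1.
have k_mono m n : (m <= n)%N -> k m `<=` k n.
  elim: n => [|n IHn]; first by rewrite leqn0 => /eqP->.
  rewrite leq_eqVlt => /predU1P[->//|/IHn kmn] x /kmn; case: (S_step n) => + _ _ _ _.
  exact.
have forb_mono m n : (m <= n)%N -> {subset (S m).2 <= (S n).2}.
  elim: n => [|n IHn]; first by rewrite leqn0 => /eqP->.
  rewrite leq_eqVlt => /predU1P[->//|/IHn kmn] x /kmn; case: (S_step n) => _ _ + _ _.
  exact.
have sub_k n : subfield_of_algC (k n) by case: (S_ok n).
pose F := \bigcup_n k n.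
have common x y : F x -> F y -> exists n, k n x /\ k n y.
  move=> [m _ mx] [n _ ny]; exists (maxn m n).
  by split; [apply: k_mono mx; rewrite leq_maxl|apply: k_mono ny; rewrite leq_maxr].
exists F; split.
- apply/subfieldP; split=> [|x y Fx Fy|x y Fx Fy]; first by exists 0%N => //; apply: subfield1.
    by have [n [nx ny]] := common x y Fx Fy; exists n => //; apply: subfieldB.
  by have [n [nx ny]] := common x y Fx Fy; exists n => //; apply: subfield_div.
- by move=> x Kx; exists 0%N.
- move=> x [n _ +] hx; elim: n => [//|n IHn] kx; apply: IHn; apply: contrapT => nkx.
  by case: (S_step n) => _ _ _ /(_ x kx nkx).
- move=> n FG; case: (S_step n) => _ [y ky nky] _ _ [Gk|[x xS Gx]].
    by apply: nky; apply: Gk; rewrite -FG; exists n.+1.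
  have [m _ kx] : F x by rewrite FG.
  have [_ _ /(_ x)] := S_ok (maxn m n.+1); apply.
    by apply: forb_mono xS; rewrite leq_maxr.
  by apply: k_mono kx; rewrite leq_maxl.
Qed.

End Tower.

Unset Implicit Arguments.

Theorem lemma0p4 (R : realType) (C : R) (K : set algC) :
  0 < C -> number_field K ->
  ~ countable [set F : set algC |
      algebraic_extension K F /\ (C%:E < northcott_number R F)%E].
Proof.
move=> _ nfK; case: (nfK) => subK [s KE]; set X := [set F | _].
move=> /countable_injP[f f_inj].
have G_ex n : exists G, forall F, X F -> f F = n -> F = G.
  have [[F [XF fF]]|nF] := EM (exists F, X F /\ f F = n).
    by exists F => F' XF' fF'; apply: f_inj; rewrite ?inE // fF'.
  by exists set0 => F XF fF; case: nF; exists F.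
have [G GP] := choice G_ex.
have [F [subF KF heightF FG]] := diagonal_extension (C + 1) G nfK.
suff XF : X F by apply: (FG (f F)); apply: GP.
split.
  split=> // x _; exists (minCpoly x).
  rewrite minCpoly_eq0 root_minCpoly; split=> //.
  have [p [-> _] _] := minCpolyP x; apply/(all_nthP 0) => i _.
  by rewrite coef_map inE; apply: subfield_rat.
apply: (@lt_le_trans _ _ (C + 1)%:E); first by rewrite lte_fin ltrDl.
apply: le_ereal_inf_tmp => _ [t [_ inf_t] <-]; rewrite lee_fin leNgt; apply/negP => tC.
apply: inf_t; apply: sub_finite_set (northcott_finite (size s) (C + 1)).
move=> x [Fx hx]; have hx' : (weil_height R x < (C + 1)%:E)%E.
  by apply: lt_trans hx _; rewrite lte_fin.
by split=> //; apply: (span_degree_le subK KE); apply: heightF.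
Qed.
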